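(* Every exponent of $q$ occurring in $$S^*(\tau)=q^{-1}F^{\vee}_{0,0}(q)+q^{12/5}F^{\vee}_{-13/5,\,93/5}(q)-q^{2/5}F^{\vee}_{3/5,\,62/5}(q)$$ belongs to one of the classes $0,2/5,3/5$ modulo $\mathbb Z$, so there is a unique decomposition $S^*=S_0+S_2+S_3$ with $S_j\in q^{j/5}\mathbb Z((q))$ for $j\in\{0,2,3\}$. With $V(\tau)=(S_0(\tau),S_2(\tau),S_3(\tau))^{\mathsf T}$ and $\zeta_5=e^{2\pi i/5}$, one has for every $\tau\in\mathbb H$ $$V(\tau+1)=\operatorname{diag}(1,\zeta_5^2,\zeta_5^3)\,V(\tau).$$
   Context: Here $\tau\in\mathbb H=\{z\in\mathbb C:\operatorname{Im}z>0\}$, $q=e^{2\pi i\tau}$, fractional powers mean $q^c=e^{2\pi ic\tau}$, and $(x;q)_n=\prod_{j=0}^{n-1}(1-xq^j)$. For $\alpha,\beta\in\mathbb Q$, $$F^{\vee}_{\alpha,\beta}(q)=\sum_{r,s\ge0}\frac{q^{(3r^2-31rs+93s^2)/5+\alpha r+\beta s}}{(q;q)_r\,(q^{31};q^{31})_s},$$ which converges locally uniformly on $\mathbb H$ (the quadratic form is positive definite). Exponents refer to the expansion of $S^*$ as a series in fractional powers of $q$. *)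

(* Defs.v *)
From Stdlib Require Import Reals ZArith QArith Qreals List.
From Coquelicot Require Import Coquelicot.
Open Scope C_scope.

(* Functions on the upper half-plane are total functions C -> C, only ever
   constrained or compared at points of [upper_half]. *)
Definition upper_half (tau : C) : Prop := (0 < Im tau)%R.

Definition eq_on_upper_half (f g : C -> C) : Prop :=
  forall tau : C, upper_half tau -> f tau = g tau.

Definition Cexp (z : C) : C :=
  RtoC (exp (Re z)) * (cos (Im z), sin (Im z)).

(* q^c = e^(2 pi i c tau). *)
Definition qpow (c : R) (tau : C) : C :=
  Cexp (2 * RtoC PI * Ci * RtoC c * tau).

(* (x; q)_n = prod_(0 <= j < n) (1 - x q^j). *)
Fixpoint qpoch (x q : C) (n : nat) : C :=
  match n with
  | O => 1
  | S m => qpoch x q m * (1 - x * q ^ m)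
  end.

(* Unordered summation: [l] is the limit of the finite partial sums of [a]
   along the finite subsets (duplicate-free lists) of [I] ordered by
   inclusion. *)
Definition Csum_list {I : Type} (a : I -> C) (L : list I) : C :=
  fold_right (fun i z => a i + z) 0 L.

Definition is_unordered_sum {I : Type} (a : I -> C) (l : C) : Prop :=
  forall eps : R, (0 < eps)%R ->
  exists L0 : list I, forall L : list I,
    NoDup L -> incl L0 L -> (Cmod (Csum_list a L - l) < eps)%R.

(* The value of the sum; meaningful when the family is summable. *)
Definition unordered_sum {I : Type} (a : I -> C) : C :=
  iota (T := C_CompleteNormedModule) (is_unordered_sum a).

Definition Fvee_exponent (alpha beta : Q) (r s : nat) : R :=
  (3 * INR r ^ 2 - 31 * INR r * INR s + 93 * INR s ^ 2) / 5
  + Q2R alpha * INR r + Q2R beta * INR s.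

Definition Fvee (alpha beta : Q) (tau : C) : C :=
  unordered_sum (fun rs : nat * nat =>
    let (r, s) := rs in
    let q := qpow 1 tau in
    qpow (Fvee_exponent alpha beta r s) tau
      / (qpoch q q r * qpoch (q ^ 31) (q ^ 31) s)).

Definition Sstar (tau : C) : C :=
  qpow (-1) tau * Fvee 0 0 tau
  + qpow (12 / 5) tau * Fvee (-13 # 5) (93 # 5) tau
  - qpow (2 / 5) tau * Fvee (3 # 5) (62 # 5) tau.

(* f(tau) = sum_(n >= 0) a_n q^(e_n) for every tau in the upper half-plane. *)
Definition has_q_series (e : nat -> R) (a : nat -> C) (f : C -> C) : Prop :=
  forall tau : C, upper_half tau ->
    is_series (V := C_NormedModule) (fun n => a n * qpow (e n) tau) (f tau).

(* The exponents of a series in q^(1/D) starting at q^(N/D). *)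
Definition frac_exponent (D : positive) (N : Z) (n : nat) : R :=
  IZR (N + Z.of_nat n) / IZR (Zpos D).

Definition has_frac_expansion (D : positive) (N : Z) (a : nat -> C)
    (f : C -> C) : Prop :=
  has_q_series (frac_exponent D N) a f.

Definition q_exponent_of (f : C -> C) (e : R) : Prop :=
  exists (D : positive) (N : Z) (a : nat -> C) (n : nat),
    has_frac_expansion D N a f /\ a n <> 0 /\ e = frac_exponent D N n.

Definition cong_mod_Z (x y : R) : Prop := exists k : Z, (x = y + IZR k)%R.

(* f belongs to q^c Z((q)). *)
Definition in_qZ_laurent (c : R) (f : C -> C) : Prop :=
  exists (N : Z) (a : nat -> Z),
    has_q_series (fun n => (c + IZR (N + Z.of_nat n))%R)
      (fun n => RtoC (IZR (a n))) f.

Definition is_decomposition (f f0 f2 f3 : C -> C) : Prop :=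
  in_qZ_laurent 0 f0 /\ in_qZ_laurent (2 / 5) f2 /\ in_qZ_laurent (3 / 5) f3 /\
  eq_on_upper_half f (fun tau => f0 tau + f2 tau + f3 tau).

Definition zeta5 : C := Cexp (2 * RtoC PI * Ci / 5).

Definition col3 (x y z : C) : matrix (T := C) 3 1 :=
  mk_matrix 3 1 (fun i _ => nth i (x :: y :: z :: nil) 0).

Definition diag3 (x y z : C) : matrix (T := C) 3 3 :=
  mk_matrix 3 3 (fun i j =>
    if Nat.eqb i j then nth i (x :: y :: z :: nil) 0 else 0).

(* Main.v *)
Require Import Defs.
From Stdlib Require Import Reals Lra Lia ZArith QArith Qreals List FinFun.
From Stdlib Require Import Classical ClassicalEpsilon Eqdep.
From Coquelicot Require Import Coquelicot.
Open Scope C_scope.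

(* Put y = q^(1/5). Expanding each 1/(q; q)_r as a generating function of
   partitions turns q^(c/5) F_(a/5, b/5) into q^(-60) times a sum of monomials
   y^n over one big index set; the factor q^(-60), smaller than necessary, makes
   all exponents n nonnegative. This sum converges absolutely because the
   quadratic form is positive definite, so it may be summed over the fibres of
   (r, s), which gives back F, or over those of n, which gives a series in y
   with integer coefficients. Modulo 5, n for the three terms is
   3 u^2, 3 u^2 + 2 u + 2 and 3 u^2 + 3 u + 2 with u = r - s, and each of these
   only takes the values 0, 2, 3.
   The translation T : tau -> tau + 1 multiplies q^e by exp(2 pi i e). Hence the
   three components are eigenvectors of T for distinct eigenvalues, which makes
   them unique, and (T - 1)(T - zeta^2)(T - zeta^3) annihilates S*, which by
   uniqueness of power series coefficients confines the exponents of any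
   expansion. *)

(** * Unordered sums *)

(** Index types are arbitrary, so equality is decided classically: a boolean for [filter], a
    [sumbool] ([classic_dec]) for [nodup]. *)
Definition eqb_dec {I : Type} (x y : I) : bool :=
  if excluded_middle_informative (x = y) then true else false.

Lemma eqb_decP {I : Type} (x y : I) : eqb_dec x y = true <-> x = y.
Proof.
unfold eqb_dec; destruct (excluded_middle_informative (x = y)); split; easy.
Qed.

Definition classic_dec {I : Type} (x y : I) : {x = y} + {x <> y} :=
  excluded_middle_informative (x = y).

Definition Rsum_list {I : Type} (u : I -> R) (L : list I) : R :=
  fold_right (fun i z => u i + z)%R 0%R L.

(** For nonnegative [u] this is summability with an explicit bound, phrased through finite partial
    sums so that no limit has to be named. *)
Definition sum_le {I : Type} (u : I -> R) (M : R) : Prop :=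
  forall L : list I, NoDup L -> (Rsum_list u L <= M)%R.

Section FiniteSums.
Context {I J : Type}.
Implicit Types (a b : I -> C) (u v : I -> R) (L : list I).

Lemma Csum_list_app a L1 L2 :
  Csum_list a (L1 ++ L2) = Csum_list a L1 + Csum_list a L2.
Proof.
induction L1 as [|i L1 IH]; simpl; [now rewrite Cplus_0_l|].
rewrite IH; ring.
Qed.

Lemma Csum_list_ext a b L :
  (forall i, In i L -> a i = b i) -> Csum_list a L = Csum_list b L.
Proof.
induction L as [|i L IH]; simpl; intros H; [easy|].
rewrite IH, H; auto.
Qed.

Lemma Csum_list_plus a b L :
  Csum_list (fun i => a i + b i) L = Csum_list a L + Csum_list b L.
Proof. induction L as [|i L IH]; simpl; [ring|]. rewrite IH; ring. Qed.

Lemma Csum_list_scal c a L :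
  Csum_list (fun i => c * a i) L = c * Csum_list a L.
Proof. induction L as [|i L IH]; simpl; [ring|]. rewrite IH; ring. Qed.

Lemma Csum_list_RtoC u L :
  Csum_list (fun i => RtoC (u i)) L = RtoC (Rsum_list u L).
Proof. induction L as [|i L IH]; simpl; [easy|]. now rewrite IH, RtoC_plus. Qed.

Lemma Cmod_Csum_list a L :
  (Cmod (Csum_list a L) <= Rsum_list (fun i => Cmod (a i)) L)%R.
Proof.
induction L as [|i L IH]; simpl; [rewrite Cmod_0; lra|].
eapply Rle_trans; [apply Cmod_triangle|]. lra.
Qed.

Lemma Csum_list_flat_map a (g : J -> list I) K :
  Csum_list a (flat_map g K) = Csum_list (fun j => Csum_list a (g j)) K.
Proof.
induction K as [|j K IH]; simpl; [easy|]. now rewrite Csum_list_app, IH.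
Qed.

Lemma Csum_list_map a (f : J -> I) K :
  Csum_list a (map f K) = Csum_list (fun j => a (f j)) K.
Proof. induction K as [|j K IH]; simpl; [easy|]. now rewrite IH. Qed.

Lemma Rsum_list_app u L1 L2 :
  Rsum_list u (L1 ++ L2) = (Rsum_list u L1 + Rsum_list u L2)%R.
Proof.
induction L1 as [|i L1 IH]; simpl; [lra|]. rewrite IH; lra.
Qed.

Lemma Rsum_list_map u (f : J -> I) K :
  Rsum_list u (map f K) = Rsum_list (fun j => u (f j)) K.
Proof. induction K as [|j K IH]; simpl; [easy|]. now rewrite IH. Qed.

Lemma Rsum_list_le u v L :
  (forall i, In i L -> u i <= v i)%R -> (Rsum_list u L <= Rsum_list v L)%R.
Proof.
induction L as [|i L IH]; simpl; intros H; [lra|].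
apply Rplus_le_compat; auto.
Qed.

Lemma Rsum_list_ext u v L :
  (forall i, In i L -> u i = v i) -> Rsum_list u L = Rsum_list v L.
Proof.
induction L as [|i L IH]; simpl; intros H; [easy|].
rewrite IH, H; auto.
Qed.

Lemma Rsum_list_plus u v L :
  Rsum_list (fun i => u i + v i)%R L = (Rsum_list u L + Rsum_list v L)%R.
Proof. induction L as [|i L IH]; simpl; [ring|]. rewrite IH; ring. Qed.

Lemma Rsum_list_scal c u L :
  Rsum_list (fun i => c * u i)%R L = (c * Rsum_list u L)%R.
Proof. induction L as [|i L IH]; simpl; [ring|]. rewrite IH; ring. Qed.

Lemma Rsum_list_const c L :
  Rsum_list (fun _ : I => c) L = (INR (length L) * c)%R.
Proof.
induction L as [|i L IH]; [simpl; ring|].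
change (length (i :: L)) with (S (length L)). rewrite S_INR. simpl.
rewrite IH; ring.
Qed.

Lemma Rsum_list_incl u L1 L2 :
  (forall i, 0 <= u i)%R -> NoDup L1 -> incl L1 L2 ->
  (Rsum_list u L1 <= Rsum_list u L2)%R.
Proof.
intros u0 N1; revert L2; induction N1 as [|i L1 Hi N1 IH]; intros L2 S12.
- simpl. clear S12. induction L2 as [|k L2 IH]; simpl; [lra|].
  specialize (u0 k); lra.
- destruct (in_split i L2) as [A [B E]]; [apply S12; now left|].
  subst L2. rewrite Rsum_list_app; simpl.
  assert (Rsum_list u L1 <= Rsum_list u (A ++ B))%R as H.
  { apply IH. intros k Hk. specialize (S12 k (or_intror Hk)).
    apply in_app_iff in S12. apply in_app_iff.
    destruct S12 as [?|[?|?]]; auto. subst k; contradiction. }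
  rewrite Rsum_list_app in H; lra.
Qed.

Lemma Rsum_list_indicator (j : I) c L :
  NoDup L -> In j L ->
  Rsum_list (fun i => if eqb_dec j i then c else 0%R) L = c.
Proof.
induction L as [|k L IH]; simpl; intros N Hj; [easy|].
inversion_clear N as [|? ? Hk N'].
destruct Hj as [E|Hj].
- subst k. rewrite (proj2 (eqb_decP j j) eq_refl).
  rewrite (Rsum_list_ext _ (fun _ => 0%R)), Rsum_list_const; [ring|].
  intros i Hi. destruct (eqb_dec j i) eqn:E; [|easy].
  apply (proj1 (eqb_decP _ _)) in E; congruence.
- rewrite IH by assumption.
  destruct (eqb_dec j k) eqn:E; [|ring].
  apply (proj1 (eqb_decP _ _)) in E; congruence.
Qed.

End FiniteSums.

Lemma Rsum_list_partition {I J : Type} (f : I -> J) (u : I -> R)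
    (L : list I) (K : list J) :
  NoDup K -> (forall i, In i L -> In (f i) K) ->
  Rsum_list u L =
  Rsum_list (fun j => Rsum_list u (filter (fun i => eqb_dec (f i) j) L)) K.
Proof.
intros NK. induction L as [|i L IH]; simpl; intros H.
- rewrite Rsum_list_const; ring.
- rewrite IH by auto.
  (* [u i] is spread over [K] as an indicator: it lands in the single fibre above [f i]. *)
  rewrite <- (Rsum_list_indicator (f i) (u i) K) at 1 by auto.
  rewrite <- Rsum_list_plus. apply Rsum_list_ext. intros j _.
  destruct (eqb_dec (f i) j); simpl; ring.
Qed.

Lemma sum_le_fibers {I J : Type} (f : I -> J) (u : I -> R) (b : J -> R) M :
  (forall j L, NoDup L -> (forall i, In i L -> f i = j) ->
     Rsum_list u L <= b j)%R ->
  sum_le b M -> sum_le u M.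
Proof.
intros Hf Hb L NL.
(* Only the finitely many fibres that meet [L] matter. *)
pose (K := nodup classic_dec (map f L)).
assert (NoDup K) as NK by apply NoDup_nodup.
rewrite (Rsum_list_partition f u L K NK).
2:{ intros i Hi. apply nodup_In, in_map, Hi. }
eapply Rle_trans; [|apply (Hb K NK)].
apply Rsum_list_le. intros j _. apply Hf.
- now apply NoDup_filter.
- intros i Hi. apply filter_In in Hi. now apply (proj1 (eqb_decP _ _)).
Qed.

(** Eliminating [projT1 i = j] once, element by element, lets a list in a fibre be treated as a list
    over [K j], with no transport along equalities later. *)
Lemma fiber_list_map {J : Type} {K : J -> Type} (j : J) (L : list {j : J & K j}) :
  (forall i, In i L -> projT1 i = j) -> exists L', L = map (existT K j) L'.
Proof.
induction L as [|[j' k] L IH]; intros H.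
- now exists nil.
- destruct IH as [L' ->]; [intros; apply H; now right|].
  assert (E : j' = j) by (apply (H (existT K j' k)); now left).
  subst j'. now exists (k :: L').
Qed.

Lemma sum_le_sigma {J : Type} {K : J -> Type} (u : {j : J & K j} -> R) b M :
  (forall j, sum_le (fun k => u (existT K j k)) (b j)) ->
  sum_le b M -> sum_le u M.
Proof.
intros Hf. apply (sum_le_fibers (@projT1 J K)). intros j L NL HL.
destruct (fiber_list_map j L HL) as [L' ->].
rewrite Rsum_list_map. apply Hf. eapply NoDup_map_inv, NL.
Qed.

Lemma sum_le_le {I : Type} (u v : I -> R) M :
  (forall i, u i <= v i)%R -> sum_le v M -> sum_le u M.
Proof.
intros H Hv L NL. eapply Rle_trans; [|apply (Hv L NL)].
apply Rsum_list_le; auto.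
Qed.

Lemma sum_le_weaken {I : Type} (u : I -> R) M M' :
  (M <= M')%R -> sum_le u M -> sum_le u M'.
Proof. intros H Hu L NL. specialize (Hu L NL); lra. Qed.

Lemma sum_le_scal {I : Type} (u : I -> R) c M :
  (0 <= c)%R -> sum_le u M -> sum_le (fun i => c * u i)%R (c * M).
Proof.
intros c0 Hu L NL. rewrite Rsum_list_scal.
apply Rmult_le_compat_l; auto.
Qed.

Lemma sum_le_plus {I : Type} (u v : I -> R) M N :
  sum_le u M -> sum_le v N -> sum_le (fun i => u i + v i)%R (M + N).
Proof.
intros Hu Hv L NL. rewrite Rsum_list_plus.
specialize (Hu L NL); specialize (Hv L NL); lra.
Qed.

Lemma sum_le_inj {I J : Type} (f : J -> I) (u : I -> R) M :
  (forall x y, f x = f y -> x = y) -> sum_le u M ->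
  sum_le (fun j => u (f j)) M.
Proof.
intros inj Hu L NL. rewrite <- (Rsum_list_map u f). apply Hu.
apply Injective_map_NoDup; auto.
Qed.

Section UnorderedSums.
Context {I : Type}.
Implicit Types (a b : I -> C) (u v : I -> R).

Lemma is_unordered_sum_unique a l l' :
  is_unordered_sum a l -> is_unordered_sum a l' -> l = l'.
Proof.
intros H H'.
destruct (excluded_middle_informative (l = l')) as [E|E]; [exact E|exfalso].
assert (l - l' <> 0) as D.
{ intros D. apply E. replace l with (l - l' + l') by ring. rewrite D; ring. }
apply Cmod_gt_0 in D.
destruct (H (Cmod (l - l') / 2)%R) as [L1 H1]; [lra|].
destruct (H' (Cmod (l - l') / 2)%R) as [L2 H2]; [lra|].
pose (L := nodup classic_dec (L1 ++ L2)).
assert (NL : NoDup L) by apply NoDup_nodup.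
assert (S1 : incl L1 L).
{ intros i Hi. apply nodup_In, in_app_iff; now left. }
assert (S2 : incl L2 L).
{ intros i Hi. apply nodup_In, in_app_iff; now right. }
specialize (H1 L NL S1). specialize (H2 L NL S2).
assert (T := Cmod_triangle (- (Csum_list a L - l)) (Csum_list a L - l')).
rewrite Cmod_opp in T.
replace (- (Csum_list a L - l) + (Csum_list a L - l')) with (l - l') in T by ring.
lra.
Qed.

Lemma unordered_sum_eq a l : is_unordered_sum a l -> unordered_sum a = l.
Proof.
intros H. apply (iota_unique (V := C_CompleteNormedModule)); [|exact H].
intros y Hy. eapply is_unordered_sum_unique; eassumption.
Qed.

Lemma is_unordered_sum_ext a b l :
  (forall i, a i = b i) -> is_unordered_sum a l -> is_unordered_sum b l.
Proof.
intros E H eps He. destruct (H eps He) as [L0 H0]. exists L0.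
intros L NL SL. rewrite <- (Csum_list_ext a b L); auto.
Qed.

Lemma is_unordered_sum_plus a b la lb :
  is_unordered_sum a la -> is_unordered_sum b lb ->
  is_unordered_sum (fun i => a i + b i) (la + lb).
Proof.
intros Ha Hb eps He.
destruct (Ha (eps / 2)%R) as [L1 H1]; [lra|].
destruct (Hb (eps / 2)%R) as [L2 H2]; [lra|].
exists (L1 ++ L2). intros L NL SL. apply incl_app_inv in SL.
specialize (H1 L NL (proj1 SL)). specialize (H2 L NL (proj2 SL)).
rewrite Csum_list_plus.
replace (_ - _) with ((Csum_list a L - la) + (Csum_list b L - lb)) by ring.
eapply Rle_lt_trans; [apply Cmod_triangle|]. lra.
Qed.

Lemma is_unordered_sum_scal c a l :
  is_unordered_sum a l -> is_unordered_sum (fun i => c * a i) (c * l).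
Proof.
intros H eps He.
assert (c0 := Cmod_ge_0 c).
destruct (H (eps / (Cmod c + 1))%R) as [L0 H0].
{ apply Rdiv_lt_0_compat; lra. }
exists L0. intros L NL SL. specialize (H0 L NL SL).
rewrite Csum_list_scal.
replace (_ - _) with (c * (Csum_list a L - l)) by ring.
rewrite Cmod_mult.
apply (Rmult_lt_compat_l (Cmod c + 1)) in H0; [|lra].
replace ((Cmod c + 1) * (eps / (Cmod c + 1)))%R with eps in H0 by (field; lra).
assert (z0 := Cmod_ge_0 (Csum_list a L - l)). lra.
Qed.

Lemma nonneg_summable u M :
  (forall i, 0 <= u i)%R -> sum_le u M ->
  exists l, is_unordered_sum (fun i => RtoC (u i)) l.
Proof.
intros u0 Hu.
(* The limit is the supremum of the finite partial sums; by monotonicity every list containing a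
   nearly optimal one is at least as close to it. *)
destruct (completeness (fun x => exists L, NoDup L /\ x = Rsum_list u L))
  as [l [ub lub]].
- exists M. intros x [L [NL ->]]; auto.
- exists 0%R, nil; split; [constructor|easy].
- exists (RtoC l). intros eps He.
  assert (exists L, NoDup L /\ l - eps < Rsum_list u L)%R as [L0 [N0 H0]].
  { apply NNPP. intros no. assert (l <= l - eps)%R; [|lra].
    apply lub. intros x [L [NL ->]].
    apply Rnot_lt_le. intros lt. apply no. now exists L. }
  exists L0. intros L NL SL.
  assert (H1 := Rsum_list_incl u L0 L u0 N0 SL).
  assert (H2 : (Rsum_list u L <= l)%R) by (apply ub; now exists L).
  rewrite Csum_list_RtoC, <- RtoC_minus, Cmod_R, Rabs_left1; lra.
Qed.

Lemma real_summable u M :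
  sum_le (fun i => Rabs (u i)) M ->
  exists l, is_unordered_sum (fun i => RtoC (u i)) l.
Proof.
intros Hu.
(* Positive and negative parts, each dominated by |u|. *)
destruct (nonneg_summable (fun i => (Rabs (u i) + u i) / 2)%R M) as [l1 H1].
{ intros i. assert (h := Rle_abs (- u i)). rewrite Rabs_Ropp in h. lra. }
{ eapply sum_le_le, Hu. intros i. assert (h := Rle_abs (u i)). simpl. lra. }
destruct (nonneg_summable (fun i => (Rabs (u i) - u i) / 2)%R M) as [l2 H2].
{ intros i. assert (h := Rle_abs (u i)). lra. }
{ eapply sum_le_le, Hu. intros i. assert (h := Rle_abs (- u i)).
  rewrite Rabs_Ropp in h. simpl. lra. }
eexists. eapply is_unordered_sum_ext;
  [|exact (is_unordered_sum_plus _ _ _ _ H1 (is_unordered_sum_scal (-1) _ _ H2))].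
intros i. simpl. rewrite <- RtoC_mult, <- RtoC_plus. f_equal. field.
Qed.

Lemma summable a M :
  sum_le (fun i => Cmod (a i)) M -> exists l, is_unordered_sum a l.
Proof.
intros Ha.
destruct (real_summable (fun i => Re (a i)) M) as [l1 H1].
{ eapply sum_le_le, Ha. intros i. apply re_le_Cmod. }
destruct (real_summable (fun i => Im (a i)) M) as [l2 H2].
{ eapply sum_le_le, Ha. intros i.
  eapply Rle_trans; [apply Rmax_r|apply Rmax_Cmod]. }
eexists. eapply is_unordered_sum_ext;
  [|exact (is_unordered_sum_plus _ _ _ _ H1 (is_unordered_sum_scal Ci _ _ H2))].
intros i. simpl. destruct (a i) as [x y].
unfold RtoC, Cplus, Cmult, Ci; simpl. f_equal; ring.
Qed.

(** Converse of [nonneg_summable]: partial sums of nonnegative terms only grow with the list, so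
    none can exceed the limit. The bound is [Cmod l] because [l] is given as a complex number. *)
Lemma sum_le_of_sum u l :
  (forall i, 0 <= u i)%R -> is_unordered_sum (fun i => RtoC (u i)) l ->
  sum_le u (Cmod l).
Proof.
intros u0 H L NL. apply Rnot_lt_le. intros lt.
destruct (H (Rsum_list u L - Cmod l)%R) as [L0 H0]; [lra|].
pose (L1 := nodup classic_dec (L0 ++ L)).
assert (N1 : NoDup L1) by apply NoDup_nodup.
assert (S0 : incl L0 L1).
{ intros i Hi. apply nodup_In, in_app_iff; now left. }
assert (S1 : incl L L1).
{ intros i Hi. apply nodup_In, in_app_iff; now right. }
specialize (H0 L1 N1 S0).
assert (H1 := Rsum_list_incl u L L1 u0 NL S1).
assert (T := Cmod_triangle (Csum_list (fun i => RtoC (u i)) L1 - l) l).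
replace (Csum_list _ L1 - l + l) with (RtoC (Rsum_list u L1)) in T.
2:{ rewrite Csum_list_RtoC; ring. }
rewrite Cmod_R in T. assert (h := Rle_abs (Rsum_list u L1)). lra.
Qed.

End UnorderedSums.

(* The hypothesis says that each fibre sum [b j] is approximated by finite
   sums over arbitrarily large finite parts of the fibre. *)
Lemma is_unordered_sum_fibers {I J : Type} (f : I -> J) (a : I -> C) b l :
  (forall j eps L0, (0 < eps)%R -> (forall i, In i L0 -> f i = j) ->
     exists L, NoDup L /\ incl L0 L /\ (forall i, In i L -> f i = j) /\
       (Cmod (Csum_list a L - b j) < eps)%R) ->
  is_unordered_sum a l -> is_unordered_sum b l.
Proof.
intros Hf Ha eps He.
destruct (Ha (eps / 2)%R) as [L0 H0]; [lra|].
exists (map f L0). intros K NK SK.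
(* At most [length K] fibre errors of size [eta] add up to at most eps/2; the + 1 covers an empty
   [K]. *)
pose (eta := (eps / (2 * (INR (length K) + 1)))%R).
assert (nK := pos_INR (length K)).
assert (He' : (0 < eta)%R) by (apply Rdiv_lt_0_compat; lra).
assert (ch : forall j, exists L, NoDup L /\
    incl (filter (fun i => eqb_dec (f i) j) L0) L /\
    (forall i, In i L -> f i = j) /\ (Cmod (Csum_list a L - b j) < eta)%R).
{ intros j. apply Hf; [exact He'|]. intros i Hi. apply filter_In in Hi.
  now apply (proj1 (eqb_decP _ _)). }
pose (g := fun j => proj1_sig (constructive_indefinite_description _ (ch j))).
assert (Hg : forall j, NoDup (g j) /\
    incl (filter (fun i => eqb_dec (f i) j) L0) (g j) /\
    (forall i, In i (g j) -> f i = j) /\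
    (Cmod (Csum_list a (g j) - b j) < eta)%R).
{ intros j. unfold g. apply proj2_sig. }
clearbody g.
(* Concatenating the chosen lists [g j] over [K] gives a duplicate-free list that contains [L0], so
   its sum is close both to [l] and to the sum of [b] over [K]. *)
assert (NL : NoDup (flat_map g K)).
{ clear SK ch H0. clearbody eta. clear nK. induction NK as [|j K Hj NK IH]; simpl; [constructor|].
  apply NoDup_app; [apply Hg| |].
  - exact IH.
  - intros i Hi Hi'. apply in_flat_map in Hi'. destruct Hi' as [j' [Hj' Hi']].
    apply Hg in Hi. apply Hg in Hi'. congruence. }
assert (SL : incl L0 (flat_map g K)).
{ intros i Hi. apply in_flat_map. exists (f i). split.
  - apply SK, in_map, Hi.
  - apply Hg. apply filter_In. split; [exact Hi|now apply (proj2 (eqb_decP _ _))]. }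
specialize (H0 _ NL SL). rewrite Csum_list_flat_map in H0.
assert (D : (Cmod (Csum_list b K - Csum_list (fun j => Csum_list a (g j)) K)
   <= eps / 2)%R).
{ replace (Csum_list b K - _)
    with (Csum_list (fun j => b j + - (1) * Csum_list a (g j)) K)
    by (rewrite Csum_list_plus, Csum_list_scal; ring).
  eapply Rle_trans; [apply Cmod_Csum_list|].
  eapply Rle_trans; [apply (Rsum_list_le _ (fun _ => eta))|].
  - intros j _. replace (b j + _) with (- (Csum_list a (g j) - b j)) by ring.
    rewrite Cmod_opp. apply Rlt_le, Hg.
  - rewrite Rsum_list_const. unfold eta.
    apply (Rmult_le_reg_r (2 * (INR (length K) + 1))); [lra|].
    field_simplify; [|lra]. nra. }
assert (T := Cmod_triangle
  (Csum_list b K - Csum_list (fun j => Csum_list a (g j)) K)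
  (Csum_list (fun j => Csum_list a (g j)) K - l)).
replace (Csum_list b K - _ + _) with (Csum_list b K - l) in T by ring.
lra.
Qed.

Lemma is_unordered_sum_sigma {J : Type} {K : J -> Type}
    (a : {j : J & K j} -> C) b l :
  (forall j, is_unordered_sum (fun k => a (existT K j k)) (b j)) ->
  is_unordered_sum a l -> is_unordered_sum b l.
Proof.
intros Hb. apply (is_unordered_sum_fibers (@projT1 J K)).
intros j eps L0 He H0.
destruct (fiber_list_map j L0 H0) as [L0' ->].
destruct (Hb j eps He) as [L1 H1].
pose (L := nodup classic_dec (L0' ++ L1)).
assert (NL : NoDup L) by apply NoDup_nodup.
exists (map (existT K j) L). repeat split.
- apply Injective_map_NoDup; [|exact NL].
  intros x y E. exact (inj_pair2 _ _ _ _ _ E).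
- apply incl_map. intros i Hi. apply nodup_In, in_app_iff; now left.
- intros i Hi. apply in_map_iff in Hi. now destruct Hi as [x [<- _]].
- rewrite Csum_list_map. apply H1; [exact NL|].
  intros i Hi. apply nodup_In, in_app_iff; now right.
Qed.

(** Absolute convergence supplies some limit of the whole family; [is_unordered_sum_sigma] then
    forces it to be the iterated sum. *)
Lemma is_unordered_sum_fubini {J : Type} {K : J -> Type}
    (a : {j : J & K j} -> C) b l M :
  sum_le (fun i => Cmod (a i)) M ->
  (forall j, is_unordered_sum (fun k => a (existT K j k)) (b j)) ->
  is_unordered_sum b l -> is_unordered_sum a l.
Proof.
intros Ha Hb Hl. destruct (summable a M Ha) as [l' H'].
assert (E := is_unordered_sum_sigma a b l' Hb H').
now rewrite (is_unordered_sum_unique b l l' Hl E).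
Qed.

(** * Unordered sums and series over the natural numbers *)

Lemma is_series_of_Cmod (a : nat -> C) (l : C) :
  (forall eps, (0 < eps)%R -> exists N, forall n, (N <= n)%nat ->
     (Cmod (sum_n (G := C_NormedModule) a n - l) < eps)%R) ->
  is_series (V := C_NormedModule) a l.
Proof.
intros H. apply filterlim_locally. intros eps.
destruct (H eps (cond_pos eps)) as [N HN]. exists N. intros n Hn.
apply C_NormedModule_mixin_compat1. apply (HN n Hn).
Qed.

Lemma is_series_Cmod (a : nat -> C) (l : C) :
  is_series (V := C_NormedModule) a l ->
  forall eps, (0 < eps)%R -> exists N, forall n, (N <= n)%nat ->
     (Cmod (sum_n (G := C_NormedModule) a n - l) < eps)%R.
Proof.
intros H eps He.
(* Balls in C are products of real intervals: a point of the ball of radius r is only known to lie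
   at distance below sqrt 2 * r. *)
assert (s2 : (0 < sqrt 2)%R) by (apply sqrt_lt_R0; lra).
assert (He' : (0 < eps / sqrt 2)%R) by (apply Rdiv_lt_0_compat; lra).
destruct (proj1 (filterlim_locally _ _) H (mkposreal _ He')) as [N HN]. exists N. intros n Hn. specialize (HN n Hn).
assert (T := C_NormedModule_mixin_compat2 _ _ _ HN). simpl in T.
replace (sqrt 2 * (eps / sqrt 2))%R with eps in T by (field; lra).
exact T.
Qed.

Lemma C_series_unique (a : nat -> C) (l l' : C) :
  is_series (V := C_NormedModule) a l -> is_series (V := C_NormedModule) a l' ->
  l = l'.
Proof. apply (filterlim_locally_unique (V := C_NormedModule)). Qed.

Lemma sum_n_Csum_list (a : nat -> C) n :
  sum_n (G := C_NormedModule) a n = Csum_list a (seq 0 (S n)).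
Proof.
induction n as [|n IH].
- rewrite sum_O. simpl. ring.
- rewrite sum_Sn, IH, (seq_S (S n)), Csum_list_app. simpl.
  change (@plus _ ?x ?y) with (x + y). ring.
Qed.

Lemma is_series_of_unordered (a : nat -> C) l :
  is_unordered_sum a l -> is_series (V := C_NormedModule) a l.
Proof.
intros H. apply is_series_of_Cmod. intros eps He.
destruct (H eps He) as [L0 H0]. exists (list_max L0). intros n Hn.
rewrite sum_n_Csum_list. apply H0; [apply seq_NoDup|].
intros i Hi. apply in_seq.
assert (h := proj1 (list_max_le L0 (list_max L0)) (le_n _)).
rewrite Forall_forall in h. specialize (h i Hi). lia.
Qed.

(** * Partition generating functions *)

(** Since [Cinv] sends 0 to 0, the identity holds for all [x] and [y], and products of Pochhammer
    denominators can be split freely. *)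
Lemma Cinv_mult (x y : C) : / (x * y) = / x * / y.
Proof.
assert (i0 : / 0 = 0).
{ unfold Cinv; simpl. apply injective_projections; simpl; unfold Rdiv; ring. }
destruct (classic (x = 0)) as [->|x0]; [now rewrite Cmult_0_l, i0, Cmult_0_l|].
destruct (classic (y = 0)) as [->|y0]; [now rewrite Cmult_0_r, i0, Cmult_0_r|].
field; auto.
Qed.

Lemma sum_le_geom (x : R) :
  (0 <= x < 1)%R -> sum_le (fun m : nat => x ^ m)%R (/ (1 - x)).
Proof.
intros Hx L NL.
assert (E : forall n, Rsum_list (fun m : nat => x ^ m)%R (seq 0 n)
    = ((1 - x ^ n) / (1 - x))%R).
{ induction n as [|n IH]; [simpl; field; lra|].
  rewrite seq_S, Rsum_list_app, IH. simpl. field; lra. }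
eapply Rle_trans; [apply (Rsum_list_incl _ L (seq 0 (S (list_max L))))|].
- intros i. apply pow_le; lra.
- exact NL.
- intros i Hi. apply in_seq.
  assert (h := proj1 (list_max_le L (list_max L)) (le_n _)).
  rewrite Forall_forall in h. specialize (h i Hi). lia.
- rewrite E. unfold Rdiv. rewrite <- (Rmult_1_l (/ (1 - x))) at 2.
  apply Rmult_le_compat_r; [apply Rlt_le, Rinv_0_lt_compat; lra|].
  assert (h := pow_le x (S (list_max L)) (proj1 Hx)). lra.
Qed.

Lemma one_minus_neq_0 (q : C) : (Cmod q < 1)%R -> 1 - q <> 0.
Proof.
intros Hq E. assert (q = 1) as ->.
{ replace q with (1 - (1 - q)) by ring. rewrite E; ring. }
rewrite Cmod_1 in Hq; lra.
Qed.

Lemma is_unordered_sum_geom (q : C) :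
  (Cmod q < 1)%R -> is_unordered_sum (fun m : nat => q ^ m) (/ (1 - q)).
Proof.
intros Hq. assert (q0 := Cmod_ge_0 q).
destruct (summable (fun m : nat => q ^ m) (/ (1 - Cmod q))) as [l Hl].
{ eapply sum_le_le, sum_le_geom; [|lra]. intros m. simpl. rewrite Cmod_pow; lra. }
assert (H := is_series_of_unordered _ _ Hl).
(* Dropping the first term and factoring out q are two ways to sum the shifted series; they give
   [l - 1 = q * l], which pins down the value. *)
assert (H1 : is_series (V := C_NormedModule) (fun m : nat => q ^ S m) (l - 1)).
{ apply is_series_incr_1.
  change (is_series (V := C_NormedModule) (fun m : nat => q ^ m) (l - 1 + 1)).
  replace (l - 1 + 1) with l by ring. exact H. }
assert (H2 := is_series_scal (V := C_NormedModule) q _ _ H).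
assert (E := C_series_unique _ _ _ H1 H2).
change (l - 1 = q * l) in E.
assert (N := one_minus_neq_0 q Hq).
replace (/ (1 - q)) with l; [exact Hl|].
transitivity ((l - q * l) * / (1 - q)); [field; exact N|].
rewrite <- E. field; exact N.
Qed.

(* [idx r] indexes the partitions into parts of size at most [r] by the
   multiplicities of the parts; [deg] is the number being partitioned. *)
Fixpoint idx (r : nat) : Type :=
  match r with
  | O => unit
  | S r' => {_ : idx r' & nat}
  end.

Fixpoint deg (r : nat) : idx r -> nat :=
  match r with
  | O => fun _ => O
  | S r' => fun p => (deg r' (projT1 p) + S r' * projT2 p)%nat
  end.

(** Each multiplicity contributes a geometric factor 1/(1 - x^j) with 1 <= j <= r, at most 1/(1 -
    x). The resulting bound is exponential in [r], which Gaussian decay will beat. *)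
Lemma sum_le_deg (x : R) r :
  (0 <= x < 1)%R -> sum_le (fun p => x ^ deg r p)%R ((/ (1 - x)) ^ r).
Proof.
intros Hx. assert (i0 : (0 < / (1 - x))%R) by (apply Rinv_0_lt_compat; lra).
induction r as [|r IH].
- intros L NL. simpl. rewrite Rsum_list_const.
  assert (length L <= 1)%nat.
  { destruct L as [|[] [|[] L]]; simpl; try lia.
    inversion_clear NL as [|? ? H _]. exfalso; apply H; now left. }
  apply le_INR in H. simpl in H. lra.
- apply (sum_le_sigma _ (fun p => / (1 - x) * x ^ deg r p)%R).
  + intros p. simpl.
    eapply sum_le_le with (v := fun m : nat => (x ^ deg r p * x ^ m)%R).
    * intros m. rewrite pow_add. apply Rmult_le_compat_l; [apply pow_le; lra|].
      rewrite pow_add.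
      assert (h : (x ^ (r * m) <= 1)%R) by (rewrite <- (pow1 (r * m)); apply pow_incr; lra).
      assert (h' := pow_le x m (proj1 Hx)). nra.
    * rewrite Rmult_comm. apply sum_le_scal; [apply pow_le; lra|].
      apply sum_le_geom, Hx.
  + simpl. apply sum_le_scal; [lra|exact IH].
Qed.

(** 1/(q; q)_r is a product of geometric series in q^j; the induction on [r] sums over the
    multiplicity of the largest part first. *)
Lemma is_unordered_sum_deg (q : C) r :
  (Cmod q < 1)%R ->
  is_unordered_sum (fun p => q ^ deg r p) (/ qpoch q q r).
Proof.
intros Hq. assert (q0 := Cmod_ge_0 q).
induction r as [|r IH].
- intros eps He. exists (tt :: nil). intros L NL SL.
  assert (E : L = tt :: nil).
  { destruct L as [|[] [|[] L]]; [|easy|].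
    - destruct (SL tt); now left.
    - inversion_clear NL as [|? ? H _]. exfalso; apply H; now left. }
  subst L. simpl. replace (1 + 0 - / 1) with (RtoC 0) by field.
  now rewrite Cmod_0.
- assert (Hq' : (Cmod (q ^ S r) < 1)%R).
  { rewrite Cmod_pow. simpl.
    assert (h : (Cmod q ^ r <= 1)%R) by (rewrite <- (pow1 r); apply pow_incr; lra).
    assert (h' := pow_le _ r q0). nra. }
  eapply (is_unordered_sum_fubini _ (fun p => / (1 - q ^ S r) * q ^ deg r p)).
  + eapply sum_le_le, (sum_le_deg (Cmod q) (S r)); [|lra].
    intros p. rewrite Cmod_pow; lra.
  + intros p. rewrite Cmult_comm.
    eapply is_unordered_sum_ext;
      [|apply is_unordered_sum_scal, is_unordered_sum_geom, Hq'].
    intros m. cbn [deg projT1 projT2].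
    now rewrite Cpow_add_r, <- Cpow_mult_r.
  + cbn [qpoch].
    replace (/ (qpoch q q r * (1 - q * q ^ r)))
      with (/ (1 - q ^ S r) * / qpoch q q r).
    * apply is_unordered_sum_scal, IH.
    * rewrite Cpow_S. symmetry. rewrite Cmult_comm. apply Cinv_mult.
Qed.

(** * Grading a family by its exponent *)

Lemma finite_fibers {I : Type} (n : I -> nat) (y : R) M :
  (0 < y)%R -> sum_le (fun i => y ^ n i)%R M ->
  forall k, exists L, NoDup L /\ (forall i, In i L <-> n i = k).
Proof.
intros y0 HM k. apply NNPP. intros no.
(* An infinite fibre would contain duplicate-free lists of every length m, with partial sums m y^k
   exceeding [M]. *)
assert (H : forall m, exists L, NoDup L /\ (forall i, In i L -> n i = k) /\ length L = m).
{ induction m as [|m [L [NL [HL Hm]]]].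
  - exists nil. repeat split; [constructor|easy].
  - assert (exists i, n i = k /\ ~ In i L) as [i [Hi Hi']].
    { apply NNPP. intros no'. apply no. exists L. split; [exact NL|].
      intros i; split; [apply HL|]. intros Hi. apply NNPP. intros Hi'.
      apply no'. now exists i. }
    exists (i :: L). repeat split.
    + now constructor.
    + intros j [<-|Hj]; auto.
    + simpl; now rewrite Hm. }
assert (yk := pow_lt y k y0).
destruct (INR_unbounded (M / y ^ k)) as [m Hm].
destruct (H m) as [L [NL [HL <-]]].
specialize (HM L NL).
rewrite (Rsum_list_ext _ (fun _ => (y ^ k)%R)), Rsum_list_const in HM.
2:{ intros i Hi. now rewrite (HL i Hi). }
apply (Rmult_lt_compat_r (y ^ k)) in Hm; [|exact yk].
unfold Rdiv in Hm. rewrite Rmult_assoc, Rinv_l in Hm; lra.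
Qed.

(** The coefficients are sizes of fibres of [n], hence natural numbers that do not depend on [y];
    summability at the one point [y0] makes the fibres finite. *)
Lemma graded_count {I : Type} (n : I -> nat) (y0 : R) M :
  (0 < y0)%R -> sum_le (fun i => y0 ^ n i)%R M ->
  exists cnt : nat -> nat,
    (forall k, cnt k <> O -> exists i, n i = k) /\
    (forall y l, is_unordered_sum (fun i => y ^ n i) l ->
       is_unordered_sum (fun k => RtoC (INR (cnt k)) * y ^ k) l).
Proof.
intros Hy HM.
pose (fib := fun k => constructive_indefinite_description _
  (finite_fibers n y0 M Hy HM k)).
exists (fun k => length (proj1_sig (fib k))). split.
- intros k. destruct (fib k) as [[|i L] [NL HL]]; simpl; [easy|].
  intros _. exists i. apply HL. now left.
- intros y l. apply (is_unordered_sum_fibers n).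
  intros k eps L0 He H0. destruct (fib k) as [L [NL HL]]; simpl.
  exists L. repeat split.
  + exact NL.
  + intros i Hi. apply HL, H0, Hi.
  + apply HL.
  + rewrite (Csum_list_ext _ (fun _ => RtoC 1 * y ^ k)).
    2:{ intros i Hi. apply HL in Hi. rewrite Hi; ring. }
    replace (Csum_list _ L) with (RtoC (INR (length L)) * y ^ k).
    2:{ clear. induction L as [|i L IH]; [simpl; ring|].
      change (length (i :: L)) with (S (length L)). rewrite S_INR, RtoC_plus.
      simpl. rewrite <- IH. ring. }
    replace (_ - _) with (RtoC 0) by ring. now rewrite Cmod_0.
Qed.

(** * Convergence for quadratic exponents *)

Lemma pow_antitone (z : R) m n :
  (0 <= z <= 1)%R -> (m <= n)%nat -> (z ^ n <= z ^ m)%R.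
Proof.
intros Hz H. replace n with (m + (n - m))%nat by lia. rewrite pow_add.
assert (h := pow_le z m (proj1 Hz)).
assert (h' : (z ^ (n - m) <= 1)%R)
  by (rewrite <- (pow1 (n - m)); apply pow_incr; lra).
nra.
Qed.

Lemma sum_le_gaussian (z B : R) :
  (0 < z < 1)%R -> (1 <= B)%R ->
  exists M, sum_le (fun r : nat => z ^ (r * r) * B ^ r)%R M.
Proof.
intros Hz HB.
destruct (pow_lt_1_zero z ltac:(rewrite Rabs_pos_eq; lra) (/ (2 * B))%R) as [N HN].
{ apply Rinv_0_lt_compat; lra. }
(* The general term is (z^r B)^r. From [N] on, z^r B is below 1/2; before [N], the term is at most
   B^r = (2B)^r (1/2)^r, and (2B)^r is at most (2B)^N. *)
exists ((2 * B) ^ N * / (1 - / 2))%R.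
eapply sum_le_le with (v := fun r : nat => ((2 * B) ^ N * (/ 2) ^ r)%R).
2:{ apply sum_le_scal; [apply pow_le; lra|]. apply sum_le_geom; lra. }
intros r. rewrite pow_mult, <- Rpow_mult_distr.
assert (zr := pow_lt z r (proj1 Hz)).
destruct (Nat.le_gt_cases N r) as [le|lt].
- assert (h : ((z ^ r * B) ^ r <= (/ 2) ^ r)%R).
  { apply pow_incr. split; [nra|]. specialize (HN r le).
    rewrite Rabs_pos_eq in HN by lra.
    apply (Rmult_lt_compat_r B) in HN; [|lra].
    replace (/ (2 * B) * B)%R with (/ 2)%R in HN by (field; lra). lra. }
  assert (h1 : (1 <= (2 * B) ^ N)%R) by (apply pow_R1_Rle; lra).
  assert (h2 : (0 < (/ 2) ^ r)%R) by (apply pow_lt; lra). nra.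
- assert (h : ((z ^ r * B) ^ r <= B ^ r)%R).
  { apply pow_incr. split; [nra|].
    assert (z ^ r <= 1)%R by (rewrite <- (pow1 r); apply pow_incr; lra). nra. }
  eapply Rle_trans; [exact h|].
  replace (B ^ r)%R with ((2 * B) ^ r * (/ 2) ^ r)%R.
  + apply Rmult_le_compat_r; [apply pow_le; lra|].
    apply Rle_pow; [lra|lia].
  + rewrite <- Rpow_mult_distr. f_equal. field.
Qed.

Lemma sum_le_prod {I J : Type} (u : I -> R) (v : J -> R) M N :
  (forall i, 0 <= u i)%R -> (0 <= N)%R -> sum_le u M -> sum_le v N ->
  sum_le (fun ij : I * J => u (fst ij) * v (snd ij))%R (N * M).
Proof.
intros u0 N0 Hu Hv.
apply (sum_le_fibers fst) with (b := fun i => (N * u i)%R).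
2:{ apply sum_le_scal; auto. }
intros i L NL HL.
assert (E : L = map (pair i) (map snd L)).
{ clear NL. induction L as [|[i' j] L IH]; simpl; [easy|].
  rewrite <- IH by (intros; apply HL; now right).
  f_equal. f_equal. apply (HL (i', j)); now left. }
rewrite E in NL |- *. apply NoDup_map_inv in NL.
rewrite Rsum_list_map. simpl. rewrite Rsum_list_scal, Rmult_comm.
apply Rmult_le_compat_r; auto.
Qed.

(** Nested dependent pairs, so that sums can be taken over the second partition, then the first,
    then (r, s). *)
Definition parts : Type :=
  {rs : nat * nat & {_ : idx (fst rs) & idx (snd rs)}}.

Definition weight (e : nat * nat -> nat) (a b : nat) (i : parts) : nat :=
  (e (projT1 i) + a * deg _ (projT1 (projT2 i)) + b * deg _ (projT2 (projT2 i)))%nat.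

Section QuadraticSeries.
Variables (e : nat * nat -> nat) (a b : nat).
Hypothesis e_growth : forall r s, (r * r + s * s <= 6 * e (r, s))%nat.
Hypotheses (a_pos : (0 < a)%nat) (b_pos : (0 < b)%nat).

(** The two partitions cost at most A^r B^s by [sum_le_deg], while [e_growth] gives x^e(r, s) <=
    z^(r^2) z^(s^2) for z = x^(1/6); the bound is a product of two Gaussian sums. *)
Lemma weight_sum_le (x : R) :
  (0 < x < 1)%R -> exists M, sum_le (fun i => x ^ weight e a b i)%R M.
Proof.
intros Hx.
assert (pw : forall k, (0 < k)%nat -> (0 < x ^ k < 1)%R).
{ intros k Hk. split; [apply pow_lt; lra|]. apply pow_lt_1_compat; [lra|lia]. }
pose (A := (/ (1 - x ^ a))%R). pose (B := (/ (1 - x ^ b))%R).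
assert (gt1 : forall t, (0 < t < 1)%R -> (1 <= / (1 - t))%R).
{ intros t Ht. rewrite <- Rinv_1 at 1. apply Rinv_le_contravar; lra. }
assert (HA : (1 <= A)%R) by apply gt1, pw, a_pos.
assert (HB : (1 <= B)%R) by apply gt1, pw, b_pos.
pose (z := exp (ln x / 6)).
assert (zx : (z ^ 6)%R = x).
{ unfold z. rewrite <- (exp_ln x) at 2 by lra.
  simpl. rewrite Rmult_1_r, <- !exp_plus. f_equal. field. }
assert (Hz : (0 < z < 1)%R).
{ split; [apply exp_pos|]. unfold z. rewrite <- exp_0. apply exp_increasing.
  assert (ln x < 0)%R by (rewrite <- ln_1; apply ln_increasing; lra). lra. }
destruct (sum_le_gaussian z A Hz HA) as [M1 H1].
destruct (sum_le_gaussian z B Hz HB) as [M2 H2].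
exists (M2 * M1)%R.
assert (M20 : (0 <= M2)%R) by exact (H2 nil (NoDup_nil _)).
apply (sum_le_sigma _ (fun rs => z ^ (fst rs * fst rs) * A ^ fst rs
   * (z ^ (snd rs * snd rs) * B ^ snd rs))%R).
2:{ apply (sum_le_prod (fun r : nat => z ^ (r * r) * A ^ r)%R
      (fun s : nat => z ^ (s * s) * B ^ s)%R); auto.
    intros r. apply Rmult_le_pos; apply pow_le; lra. }
intros [r s]. simpl fst; simpl snd.
apply sum_le_weaken with (M := (x ^ e (r, s) * B ^ s * A ^ r)%R).
{ replace (_ * _ * (_ * _))%R with (z ^ (r * r + s * s) * (B ^ s * A ^ r))%R
    by (rewrite pow_add; ring).
  rewrite Rmult_assoc. apply Rmult_le_compat_r.
  - apply Rmult_le_pos; apply pow_le; lra.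
  - rewrite <- zx, <- pow_mult.
    apply pow_antitone; [lra|apply e_growth]. }
apply (sum_le_sigma _ (fun p => x ^ e (r, s) * B ^ s * (x ^ a) ^ deg r p)%R).
- intros p. rewrite Rmult_assoc, (Rmult_comm (B ^ s)), <- Rmult_assoc.
  eapply sum_le_le; [|apply sum_le_scal, (sum_le_deg (x ^ b) s)].
  + intros p'. unfold weight. cbn [projT1 projT2].
    rewrite !pow_add, !pow_mult. apply Rle_refl.
  + apply Rmult_le_pos; apply pow_le; [lra|apply Rlt_le, pw, a_pos].
  + assert (h := pw b b_pos); lra.
- apply sum_le_scal.
  + apply Rmult_le_pos; apply pow_le; lra.
  + apply sum_le_deg. assert (h := pw a a_pos); lra.
Qed.

Lemma quadratic_q_series :
  exists cnt : nat -> nat,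
    (forall k, cnt k <> O -> exists r s m m', k = (e (r, s) + a * m + b * m')%nat) /\
    (forall y, (0 < Cmod y < 1)%R -> exists l,
       is_unordered_sum (fun rs : nat * nat => let (r, s) := rs in
         y ^ e rs / (qpoch (y ^ a) (y ^ a) r * qpoch (y ^ b) (y ^ b) s)) l /\
       is_unordered_sum (fun k => RtoC (INR (cnt k)) * y ^ k) l).
Proof.
(* 1/2 is an arbitrary sample point: the counts depend on [weight] alone and serve for all [y]. *)
destruct (weight_sum_le (/ 2)) as [M HM]; [lra|].
destruct (graded_count _ (/ 2) M ltac:(lra) HM) as [cnt [Hc Hs]].
exists cnt. split.
- intros k Hk. destruct (Hc k Hk) as [[[r s] [p p']] <-].
  exists r, s, (deg r p), (deg s p'). reflexivity.
- intros y Hy. destruct (weight_sum_le _ Hy) as [M' HM'].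
  assert (Hy' : sum_le (fun i => Cmod (y ^ weight e a b i)) M').
  { eapply sum_le_le, HM'. intros i. rewrite Cmod_pow. apply Rle_refl. }
  destruct (summable _ _ Hy') as [l Hl].
  exists l. split; [|apply Hs, Hl].
  apply (is_unordered_sum_sigma _ _ _) with (2 := Hl).
  assert (pw : forall k, (0 < k)%nat -> (Cmod (y ^ k) < 1)%R).
  { intros k Hk. rewrite Cmod_pow. apply pow_lt_1_compat; [lra|lia]. }
  intros [r s].
  (* For fixed (r, s), the second partition is summed first with [p] fixed, then [p]. *)
  eapply (is_unordered_sum_fubini _
    (fun p => y ^ e (r, s) * / qpoch (y ^ b) (y ^ b) s * (y ^ a) ^ deg r p)).
  + apply (sum_le_inj (existT (fun rs => {_ : idx (fst rs) & idx (snd rs)}) (r, s)))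
      with (2 := Hy').
    intros i j E. exact (inj_pair2 _ _ _ _ _ E).
  + intros p.
    replace (_ * _ * _) with (y ^ e (r, s) * (y ^ a) ^ deg r p * / qpoch (y ^ b) (y ^ b) s)
      by ring.
    eapply is_unordered_sum_ext;
      [|apply is_unordered_sum_scal, is_unordered_sum_deg, pw, b_pos].
    intros p'. unfold weight. cbn [projT1 projT2].
    rewrite !Cpow_add_r, !Cpow_mult_r. reflexivity.
  + unfold Cdiv. rewrite Cinv_mult.
    rewrite (Cmult_comm (/ _) (/ _)), Cmult_assoc.
    apply is_unordered_sum_scal, is_unordered_sum_deg, pw, a_pos.
Qed.

End QuadraticSeries.

(** * Powers of q and translation by 1 *)

Lemma Cexp_plus (z w : C) : Cexp (z + w) = Cexp z * Cexp w.
Proof.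
unfold Cexp. destruct z as [a b], w as [c d]. simpl.
rewrite exp_plus, cos_plus, sin_plus.
unfold Cmult, RtoC; simpl. f_equal; ring.
Qed.

Lemma Cmod_Cexp (z : C) : Cmod (Cexp z) = exp (Re z).
Proof.
unfold Cexp. rewrite Cmod_mult, Cmod_R, Rabs_pos_eq by (apply Rlt_le, exp_pos).
unfold Cmod at 1; simpl. rewrite !Rmult_1_r.
assert (h := sin2_cos2 (Im z)). unfold Rsqr in h.
rewrite Rplus_comm, h, sqrt_1. ring.
Qed.

Lemma Cexp_0 : Cexp 0 = 1.
Proof.
unfold Cexp; simpl. rewrite exp_0, cos_0, sin_0. apply Cmult_1_l.
Qed.

(** The multiplier of q^c under translation by 1. *)
Definition unit_root (c : R) : C := Cexp (2 * RtoC PI * Ci * RtoC c).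

Lemma unit_root_cos_sin (c : R) :
  unit_root c = (cos (2 * PI * c), sin (2 * PI * c)).
Proof.
unfold unit_root, Cexp.
replace (2 * RtoC PI * Ci * RtoC c) with (0, (2 * PI * c)%R)
  by (unfold Cmult, RtoC, Ci; simpl; f_equal; ring).
simpl. rewrite exp_0. apply Cmult_1_l.
Qed.

Lemma unit_root_plus (c d : R) : unit_root (c + d) = unit_root c * unit_root d.
Proof.
unfold unit_root. rewrite <- Cexp_plus. f_equal. rewrite RtoC_plus. ring.
Qed.

Lemma unit_root_eq_1 (c : R) : unit_root c = 1 <-> exists k : Z, c = IZR k.
Proof.
assert (P := PI_RGT_0). rewrite unit_root_cos_sin. split.
- intros E. apply (f_equal fst) in E. simpl in E.
  replace (2 * PI * c)%R with (2 * (PI * c))%R in E by ring.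
  (* By cos 2x = 1 - 2 sin^2 x, the real part alone forces sin(pi c) = 0. *)
  rewrite cos_2a_sin in E.
  destruct (sin_eq_0_0 (PI * c)) as [k Hk]; [nra|].
  exists k. apply (Rmult_eq_reg_l PI); lra.
- intros [k ->].
  assert (s0 : sin (PI * IZR k) = 0%R) by (apply sin_eq_0_1; exists k; ring).
  replace (2 * PI * IZR k)%R with (2 * (PI * IZR k))%R by ring.
  rewrite cos_2a_sin, sin_2a, s0. unfold RtoC. f_equal; ring.
Qed.

Lemma unit_root_eq (c d : R) : unit_root c = unit_root d <-> cong_mod_Z c d.
Proof.
assert (H : unit_root c = unit_root d * unit_root (c - d)).
{ rewrite <- unit_root_plus. f_equal. ring. }
assert (d0 : unit_root d <> 0).
{ unfold unit_root. apply Cmod_gt_0. rewrite Cmod_Cexp. apply exp_pos. }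
split.
- intros E. destruct (proj1 (unit_root_eq_1 (c - d))) as [k Hk].
  + rewrite E in H. transitivity (/ unit_root d * (unit_root d * unit_root (c - d))).
    * field; exact d0.
    * rewrite <- H. field; exact d0.
  + exists k. lra.
- intros [k Hk]. rewrite H, (proj2 (unit_root_eq_1 (c - d))).
  + ring.
  + exists k. lra.
Qed.

Lemma qpow_plus (c d : R) tau : qpow (c + d) tau = qpow c tau * qpow d tau.
Proof.
unfold qpow. rewrite <- Cexp_plus. f_equal. rewrite RtoC_plus. ring.
Qed.

Lemma qpow_0 tau : qpow 0 tau = 1.
Proof. unfold qpow. rewrite <- Cexp_0. f_equal. ring. Qed.

Lemma qpow_mul_INR (c : R) n tau : qpow (INR n * c) tau = qpow c tau ^ n.
Proof.
induction n as [|n IH].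
- simpl. rewrite Rmult_0_l. apply qpow_0.
- rewrite S_INR, Cpow_S, <- IH, <- qpow_plus. f_equal. ring.
Qed.

Lemma qpow_shift (c : R) tau : qpow c (tau + 1) = unit_root c * qpow c tau.
Proof.
unfold qpow, unit_root. rewrite <- Cexp_plus. f_equal. ring.
Qed.

Lemma Cmod_qpow (c : R) tau : Cmod (qpow c tau) = exp (- (2 * PI * c * Im tau)).
Proof.
unfold qpow. rewrite Cmod_Cexp. f_equal. destruct tau as [x y]. simpl. ring.
Qed.

Lemma Cmod_qpow_lt_1 (c : R) tau :
  (0 < c)%R -> upper_half tau -> (0 < Cmod (qpow c tau) < 1)%R.
Proof.
intros Hc Ht. rewrite Cmod_qpow. split; [apply exp_pos|].
rewrite <- exp_0. apply exp_increasing. unfold upper_half in Ht.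
assert (P := PI_RGT_0).
assert (0 < 2 * PI * c * Im tau)%R by (apply Rmult_lt_0_compat; [nra|exact Ht]).
lra.
Qed.

Lemma upper_half_shift tau : upper_half tau -> upper_half (tau + 1).
Proof. unfold upper_half. destruct tau; simpl. lra. Qed.

Lemma C_is_series_scal (c : C) (a : nat -> C) l :
  is_series (V := C_NormedModule) a l ->
  is_series (V := C_NormedModule) (fun n => c * a n) (c * l).
Proof. apply (is_series_scal (V := C_NormedModule)). Qed.

Lemma C_is_series_ext (a b : nat -> C) l :
  (forall n, a n = b n) ->
  is_series (V := C_NormedModule) a l -> is_series (V := C_NormedModule) b l.
Proof. apply (is_series_ext (V := C_NormedModule)). Qed.

(** T - lambda acts on an expansion coefficient by coefficient and keeps its exponents, so such
    operators can be iterated. *)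
Lemma has_q_series_shift e a f (lambda : C) :
  has_q_series e a f ->
  has_q_series e (fun n => (unit_root (e n) - lambda) * a n)
    (fun tau => f (tau + 1) - lambda * f tau).
Proof.
intros H tau Ht.
assert (H1 := H _ (upper_half_shift _ Ht)).
assert (H2 := C_is_series_scal (- lambda) _ _ (H _ Ht)).
assert (H3 := is_series_plus (V := C_NormedModule) _ _ _ _ H1 H2).
change (plus ?x ?y) with (x + y) in H3.
replace (f (tau + 1) - lambda * f tau) with (f (tau + 1) + - lambda * f tau) by ring.
eapply C_is_series_ext; [|exact H3].
intros n. change (plus ?x ?y) with (x + y). cbv beta. rewrite qpow_shift. ring.
Qed.

(** * Uniqueness of coefficients *)

Lemma is_series_component (p : C -> R) (a : nat -> C) l :
  (forall x y : C, p (x + y)%C = p x + p y)%R -> (forall x, Rabs (p x) <= Cmod x)%R ->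
  (forall x : C, p (- x)%C = - p x)%R ->
  is_series (V := C_NormedModule) a l -> is_series (fun n => p (a n)) (p l).
Proof.
intros pp pc pm H. apply filterlim_locally. intros eps.
destruct (is_series_Cmod a l H eps (cond_pos eps)) as [N HN].
exists N. intros n Hn. specialize (HN n Hn).
assert (E : sum_n (fun n => p (a n)) n = p (sum_n (G := C_NormedModule) a n)).
{ clear -pp. induction n as [|n IH]; [now rewrite !sum_O|].
  rewrite !sum_Sn, IH. symmetry. apply pp. }
change (Rabs (sum_n (fun n => p (a n)) n + - p l) < eps)%R. rewrite E.
rewrite <- pm, <- pp.
eapply Rle_lt_trans; [apply pc|exact HN].
Qed.

(** The constant term is the limit at 0 from the right, by continuity inside the disk of
    convergence; dividing by x and shifting reaches the other coefficients. *)
Lemma pseries_right_zero (u : nat -> R) :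
  (forall x, (0 < x < 1)%R -> is_pseries u x 0%R) -> forall n, u n = 0%R.
Proof.
intros H n. revert u H.
assert (H0 : forall u : nat -> R,
  (forall x, (0 < x < 1)%R -> is_pseries u x 0%R) -> u 0%nat = 0%R).
{ intros u H.
  (* Convergence at 1/2 makes the terms there tend to 0, which rules out a radius below 1/2. *)
  assert (cv : Rbar_lt (Rabs 0) (CV_radius u)).
  { rewrite Rabs_R0. apply Rbar_lt_le_trans with (/ 2)%R; [simpl; lra|].
    apply Rbar_not_lt_le. intros lt.
    destruct (CV_radius u) as [r| |] eqn:Er; simpl in lt.
    - pose (x := ((Rmax r 0 + / 2) / 2)%R).
      assert (r < x < / 2 /\ 0 < x)%R as [Hx Hx0].
      { unfold x, Rmax. destruct (Rle_dec r 0); lra. }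
      assert (ex : ex_series (fun n => u n * (/ 2) ^ n)%R).
      { exists 0%R. apply is_pseries_R, H. lra. }
      apply (CV_disk_outside u (/ 2)).
      + rewrite Er. simpl. rewrite Rabs_pos_eq; lra.
      + now apply ex_series_lim_0.
    - easy.
    - assert (h := CV_radius_ge_0 u). rewrite Er in h. easy. }
  assert (ct := PSeries_continuity u 0 cv).
  destruct (Req_dec (u 0%nat) 0) as [E|E]; [exact E|exfalso].
  apply continuity_pt_locally with (eps := mkposreal _ (Rabs_pos_lt _ E)) in ct.
  destruct ct as [d Hd].
  (* This point is within [d] of 0, so the sum there, which is 0, would differ from [u 0] by less
     than |u 0|. *)
  pose (x := (Rmin d 1 / 2)%R).
  assert (d0 := cond_pos d).
  assert (hx : (0 < x < 1 /\ x < d)%R) by (unfold x, Rmin; destruct (Rle_dec d 1); lra).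
  specialize (Hd x). rewrite PSeries_0 in Hd.
  rewrite (is_pseries_unique _ _ _ (H x (proj1 hx))) in Hd.
  simpl in Hd. replace (0 - u 0%nat)%R with (- u 0%nat)%R in Hd by ring.
  rewrite Rabs_Ropp in Hd. apply (Rlt_irrefl (Rabs (u 0%nat))), Hd.
  change (Rabs (x + - 0) < d)%R. rewrite Rabs_pos_eq; lra. }
induction n as [|n IH]; intros u H; [apply H0, H|].
change (PS_decr_1 u n = 0%R). apply IH. intros x Hx.
replace 0%R with (scal (/ x)%R (plus 0%R (opp (u 0%nat)))).
- apply (is_pseries_decr_1 (K := R_AbsRing) (V := R_NormedModule)); [|apply H, Hx]. change (/ x * x = 1)%R. field; lra.
- rewrite (H0 u H). change (/ x * (0 + - 0) = 0)%R. ring.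
Qed.

(** On the imaginary axis q^(1/D) runs through (0, 1). Multiplying by q^(-N/D) leaves an ordinary
    power series in that variable, whose real and imaginary parts are treated separately. *)
Lemma frac_expansion_zero D N a :
  has_frac_expansion D N a (fun _ => 0) -> forall n, a n = 0.
Proof.
intros H. assert (P := PI_RGT_0).
pose (d := IZR (Zpos D)). assert (d0 : (0 < d)%R) by (apply IZR_lt; easy).
assert (K : forall x, (0 < x < 1)%R ->
  is_series (V := C_NormedModule) (fun n => a n * RtoC (x ^ n)) (RtoC 0)).
{ intros x Hx. pose (t := (- ln x * d / (2 * PI))%R).
  assert (lx : (ln x < 0)%R) by (rewrite <- ln_1; apply ln_increasing; lra).
  assert (t0 : (0 < t)%R) by (apply Rdiv_lt_0_compat; nra).
  pose (tau := (0, t)%R : C).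
  assert (y : qpow (/ d) tau = RtoC x).
  { unfold qpow, Cexp.
    replace (2 * RtoC PI * Ci * RtoC (/ d) * tau) with (RtoC (ln x)).
    - simpl. rewrite exp_ln, cos_0, sin_0 by lra. apply Cmult_1_r.
    - unfold tau, t, Cmult, RtoC, Ci; simpl. f_equal; field; lra. }
  assert (S := C_is_series_scal (qpow (- (IZR N / d)) tau) _ _ (H tau t0)).
  rewrite Cmult_0_r in S. eapply C_is_series_ext; [|exact S].
  intros n. unfold frac_exponent. fold d.
  rewrite RtoC_pow, <- y, <- qpow_mul_INR.
  replace (IZR (N + Z.of_nat n) / d)%R with (IZR N / d + INR n * / d)%R.
  - rewrite qpow_plus.
    transitivity (a n * qpow (INR n * / d) tau
      * (qpow (- (IZR N / d)) tau * qpow (IZR N / d) tau)); [ring|].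
    rewrite <- qpow_plus. replace (- (IZR N / d) + IZR N / d)%R with 0%R by ring.
    rewrite qpow_0. ring.
  - rewrite plus_IZR, <- INR_IZR_INZ. field; lra. }
intros n. apply injective_projections.
- apply (pseries_right_zero (fun n => fst (a n))). intros x Hx.
  apply is_pseries_R.
  eapply is_series_ext; [|apply (is_series_component fst _ _) with (4 := K x Hx)].
  + intros k. simpl. ring.
  + easy.
  + intros z. apply re_le_Cmod.
  + easy.
- apply (pseries_right_zero (fun n => snd (a n))). intros x Hx.
  apply is_pseries_R.
  eapply is_series_ext; [|apply (is_series_component snd _ _) with (4 := K x Hx)].
  + intros k. simpl. ring.
  + easy.
  + intros z. eapply Rle_trans; [apply Rmax_r|apply Rmax_Cmod].
  + easy.
Qed.

(** * Expansion of [Sstar] *)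

Definition admissible (k : nat) : Prop :=
  (k mod 5 = 0 \/ k mod 5 = 2 \/ k mod 5 = 3)%nat.

(* Five times the exponent of q in the (r, s) summand of q^(c/5) F_(a/5, b/5). *)
Definition exponent5 (a b c r s : Z) : Z :=
  (3 * r * r - 31 * r * s + 93 * s * s + a * r + b * s + c)%Z.

(** Leaves only 25 residue pairs to be checked by computation. *)
Lemma exponent5_mod (a b c r s : Z) :
  (exponent5 a b c r s mod 5 = exponent5 a b c (r mod 5) (s mod 5) mod 5)%Z.
Proof.
pose (i := (r mod 5)%Z). pose (j := (s mod 5)%Z).
pose (u := (r / 5)%Z). pose (v := (s / 5)%Z).
assert (Er : r = (5 * u + i)%Z) by (apply Z_div_mod_eq_full).
assert (Es : s = (5 * v + j)%Z) by (apply Z_div_mod_eq_full).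
fold i j. rewrite Er, Es.
replace (exponent5 a b c (5 * u + i) (5 * v + j)) with
  (exponent5 a b c i j + (3 * (5 * u * u + 2 * u * i)
   - 31 * (5 * u * v + u * j + v * i) + 93 * (5 * v * v + 2 * v * j)
   + a * u + b * v) * 5)%Z by (unfold exponent5; ring).
apply Z_mod_plus_full.
Qed.

Lemma Fvee_expansion (alpha beta : Q) (a b c : Z) :
  Q2R alpha = (IZR a / 5)%R -> Q2R beta = (IZR b / 5)%R ->
  (forall r s, 0 <= r -> 0 <= s -> r * r + s * s <= 6 * (exponent5 a b c r s + 300))%Z ->
  (forall i j, 0 <= i < 5 -> 0 <= j < 5 ->
     exponent5 a b c i j mod 5 = 0 \/ exponent5 a b c i j mod 5 = 2 \/
     exponent5 a b c i j mod 5 = 3)%Z ->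
  exists cnt : nat -> nat,
    (forall k, cnt k <> O -> admissible k) /\
    forall tau, upper_half tau -> exists l M,
      is_unordered_sum (fun k => RtoC (INR (cnt k)) * qpow (1 / 5) tau ^ k) l /\
      sum_le (fun k => INR (cnt k) * Cmod (qpow (1 / 5) tau) ^ k)%R M /\
      qpow (IZR c / 5) tau * Fvee alpha beta tau = qpow (-60) tau * l.
Proof.
intros Ea Eb growth cls.
pose (E := fun rs : nat * nat =>
  exponent5 a b c (Z.of_nat (fst rs)) (Z.of_nat (snd rs))).
(* 300 = 5 * 60 accounts for q^(-60) and, as a multiple of 5, preserves residues; [growth] makes the
   argument of [Z.to_nat] nonnegative. *)
pose (e := fun rs => Z.to_nat (E rs + 300)).
assert (He : forall rs, Z.of_nat (e rs) = (E rs + 300)%Z).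
{ intros [r s]. unfold e, E; simpl.
  assert (h := growth (Z.of_nat r) (Z.of_nat s)). nia. }
(* q = y^5 and q^31 = y^155 for y = q^(1/5); both exponents are multiples of 5, so the partitions do
   not change the residue. *)
destruct (quadratic_q_series e 5 155) as [cnt [Hc Hs]].
{ intros r s. assert (h := growth (Z.of_nat r) (Z.of_nat s)).
  specialize (He (r, s)). unfold E in He; simpl in He. nia. }
{ lia. } { lia. }
exists cnt. split.
- intros k Hk. destruct (Hc k Hk) as [r [s [m [m' ->]]]].
  assert (h := cls (Z.of_nat r mod 5)%Z (Z.of_nat s mod 5)%Z).
  rewrite <- exponent5_mod in h.
  specialize (h ltac:(apply Z.mod_pos_bound; lia) ltac:(apply Z.mod_pos_bound; lia)).
  change (exponent5 a b c (Z.of_nat r) (Z.of_nat s)) with (E (r, s)) in h.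
  specialize (He (r, s)).
  assert (k5 : (Z.of_nat ((e (r, s) + 5 * m + 155 * m') mod 5) = E (r, s) mod 5)%Z).
  { rewrite Nat2Z.inj_mod, !Nat2Z.inj_add, !Nat2Z.inj_mul, He.
    replace (_ + _)%Z
      with (E (r, s) + (60 + Z.of_nat m + 31 * Z.of_nat m') * 5)%Z by lia.
    apply Z_mod_plus_full. }
  unfold admissible. lia.
- intros tau Ht. pose (y := qpow (1 / 5) tau). fold y.
  assert (Hy : (0 < Cmod y < 1)%R) by (apply Cmod_qpow_lt_1; [lra|exact Ht]).
  destruct (Hs y Hy) as [l [H1 H2]].
  (* The counts are nonnegative, so their series at |y| gives absolute convergence at [y]. *)
  destruct (Hs (RtoC (Cmod y))) as [l' [_ H3]].
  { rewrite Cmod_R, Rabs_pos_eq; lra. }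
  exists l, (Cmod l'). split; [exact H2|split].
  + apply sum_le_of_sum.
    * intros k. apply Rmult_le_pos; [apply pos_INR|apply pow_le; lra].
    * eapply is_unordered_sum_ext; [|exact H3].
      intros k. simpl. now rewrite RtoC_mult, RtoC_pow.
  + assert (EF : Fvee alpha beta tau = qpow (-60 - IZR c / 5) tau * l).
    { apply unordered_sum_eq.
      eapply is_unordered_sum_ext; [|apply is_unordered_sum_scal, H1].
      intros [r s]. cbv beta iota zeta.
      assert (y5 : forall n, y ^ n = qpow (INR n * (1 / 5)) tau)
        by (intros n; symmetry; apply qpow_mul_INR).
      replace (qpow 1 tau ^ 31) with (y ^ 155).
      2:{ rewrite y5, <- qpow_mul_INR. f_equal. simpl; lra. }
      replace (qpow 1 tau) with (y ^ 5).
      2:{ rewrite y5. f_equal. simpl; lra. }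
      unfold Cdiv. rewrite Cmult_assoc. f_equal.
      rewrite y5, <- qpow_plus. f_equal.
      rewrite INR_IZR_INZ, He. unfold E, exponent5, Fvee_exponent. simpl fst; simpl snd.
      rewrite !plus_IZR, minus_IZR, !mult_IZR, <- !INR_IZR_INZ, Ea, Eb. field. }
    rewrite EF, Cmult_assoc, <- qpow_plus. do 2 f_equal. ring.
Qed.

Lemma mod5_cases (i : Z) :
  (0 <= i < 5 -> i = 0 \/ i = 1 \/ i = 2 \/ i = 3 \/ i = 4)%Z.
Proof. lia. Qed.

Lemma Sstar_expansion :
  exists A : nat -> Z,
    (forall k, A k <> 0%Z -> admissible k) /\
    forall tau, upper_half tau -> exists l M,
      is_unordered_sum (fun k => RtoC (IZR (A k)) * qpow (1 / 5) tau ^ k) l /\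
      sum_le (fun k => Cmod (RtoC (IZR (A k)) * qpow (1 / 5) tau ^ k)) M /\
      Sstar tau = qpow (-60) tau * l.
Proof.
(* The last arguments -5, 12 and 2 of the three calls are five times the exponents of the prefactors
   q^(-1), q^(12/5) and q^(2/5). *)
destruct (Fvee_expansion 0 0 0 0 (-5)) as [c1 [A1 H1]].
{ unfold Q2R; simpl; field. } { unfold Q2R; simpl; field. }
{ intros r s r0 s0. unfold exponent5.
  (* Completing the square: 17 times the difference of the two sides is (17 r - 93 s)^2 + 820 s^2 +
     30090. *)
  assert (h := Z.square_nonneg (17 * r - 93 * s)). nia. }
{ intros i j Hi Hj.
  destruct (mod5_cases i Hi) as [->|[->|[->|[->| ->]]]];
    destruct (mod5_cases j Hj) as [->|[->|[->|[->| ->]]]]; vm_compute; auto. }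
destruct (Fvee_expansion (-13 # 5) (93 # 5) (-13) 93 12) as [c2 [A2 H2]].
{ unfold Q2R; simpl; field. } { unfold Q2R; simpl; field. }
{ intros r s r0 s0. unfold exponent5.
  (* The 39 absorbs the linear term -13 r, as 17 * 6 * 13 = 2 * 17 * 39; what remains is a
     polynomial in [s] with positive coefficients. *)
  assert (h := Z.square_nonneg (17 * r - 93 * s - 39)).
  assert (h' := Z.square_nonneg (s + 1)). nia. }
{ intros i j Hi Hj.
  destruct (mod5_cases i Hi) as [->|[->|[->|[->| ->]]]];
    destruct (mod5_cases j Hj) as [->|[->|[->|[->| ->]]]]; vm_compute; auto. }
destruct (Fvee_expansion (3 # 5) (62 # 5) 3 62 2) as [c3 [A3 H3]].
{ unfold Q2R; simpl; field. } { unfold Q2R; simpl; field. }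
{ intros r s r0 s0. unfold exponent5.
  assert (h := Z.square_nonneg (17 * r - 93 * s)). nia. }
{ intros i j Hi Hj.
  destruct (mod5_cases i Hi) as [->|[->|[->|[->| ->]]]];
    destruct (mod5_cases j Hj) as [->|[->|[->|[->| ->]]]]; vm_compute; auto. }
exists (fun k => Z.of_nat (c1 k) + Z.of_nat (c2 k) - Z.of_nat (c3 k))%Z. split.
{ intros k Hk.
  destruct (Nat.eq_dec (c1 k) 0) as [E1|]; [|auto].
  destruct (Nat.eq_dec (c2 k) 0) as [E2|]; [|auto].
  apply A3. lia. }
intros tau Ht.
destruct (H1 tau Ht) as [l1 [M1 [S1 [B1 E1]]]].
destruct (H2 tau Ht) as [l2 [M2 [S2 [B2 E2]]]].
destruct (H3 tau Ht) as [l3 [M3 [S3 [B3 E3]]]].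
exists (l1 + l2 + - (1) * l3), (M1 + M2 + M3)%R. split; [|split].
- eapply is_unordered_sum_ext;
  [|exact (is_unordered_sum_plus _ _ _ _ (is_unordered_sum_plus _ _ _ _ S1 S2)
      (is_unordered_sum_scal (- (1)) _ _ S3))].
  intros k. simpl. rewrite minus_IZR, plus_IZR, <- !INR_IZR_INZ.
  rewrite RtoC_minus, RtoC_plus. ring.
- eapply sum_le_le; [|exact (sum_le_plus _ _ _ _ (sum_le_plus _ _ _ _ B1 B2) B3)].
  intros k. simpl. rewrite Cmod_mult, Cmod_pow, Cmod_R.
  rewrite minus_IZR, plus_IZR, <- !INR_IZR_INZ.
  rewrite <- !Rmult_plus_distr_r.
  apply Rmult_le_compat_r; [apply pow_le, Cmod_ge_0|].
  assert (p1 := pos_INR (c1 k)). assert (p2 := pos_INR (c2 k)).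
  assert (p3 := pos_INR (c3 k)). apply Rabs_le. lra.
- unfold Sstar.
  replace (-1)%R with (-5 / 5)%R by field. rewrite E1.
  rewrite E2, E3. ring.
Qed.

(** * Splitting by residues modulo 5 *)

Lemma is_unordered_sum_extend {I J : Type} (f : J -> I) (a : I -> C) l :
  (forall x y, f x = f y -> x = y) ->
  (forall i, (forall j, f j <> i) -> a i = 0) ->
  is_unordered_sum (fun j => a (f j)) l -> is_unordered_sum a l.
Proof.
intros inj Hz. apply (is_unordered_sum_fibers f).
intros i eps L0 He H0.
assert (Cmod 0 < eps)%R as He' by (rewrite Cmod_0; lra).
(* A fibre of the injective [f] has at most one element, so a one-element or empty list sums it
   exactly. *)
destruct (classic (exists j, f j = i)) as [[j <-]|no].
- exists (j :: nil). repeat split.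
  + repeat constructor; easy.
  + intros x Hx. left. apply inj. symmetry. now apply H0.
  + intros x [<-|[]]. easy.
  + simpl. replace (_ - _) with (RtoC 0) by ring. exact He'.
- exists nil. repeat split; [constructor| |easy|].
  + intros x Hx. exfalso. apply no. exists x. now apply H0.
  + simpl. rewrite Hz; [|intros j E; apply no; now exists j].
    replace (_ - _) with (RtoC 0) by ring. exact He'.
Qed.

(** The term of index 5n + j has exponent j/5 + (n - 60), so for j = 0, 2, 3 this is the component
    S_j. *)
Definition residue_part (A : nat -> Z) (j : nat) (tau : C) : C :=
  qpow (-60) tau * unordered_sum (fun n =>
    RtoC (IZR (A (5 * n + j)%nat)) * qpow (1 / 5) tau ^ (5 * n + j)).

Lemma residue_split (x : nat -> C) l M :
  (forall k, x k <> 0 -> admissible k) ->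
  sum_le (fun k => Cmod (x k)) M -> is_unordered_sum x l ->
  l = unordered_sum (fun n => x (5 * n + 0)%nat) +
      unordered_sum (fun n => x (5 * n + 2)%nat) +
      unordered_sum (fun n => x (5 * n + 3)%nat) /\
  forall j, is_unordered_sum (fun n => x (5 * n + j)%nat)
    (unordered_sum (fun n => x (5 * n + j)%nat)).
Proof.
intros Hx HM Hl.
assert (Hs : forall j, is_unordered_sum (fun n => x (5 * n + j)%nat)
    (unordered_sum (fun n => x (5 * n + j)%nat))).
{ intros j.
  destruct (summable (fun n => x (5 * n + j)%nat) M) as [lj Hj].
  - apply (sum_le_inj (fun n => (5 * n + j)%nat) (fun k => Cmod (x k)));
      [intros; lia|exact HM].
  - now rewrite (unordered_sum_eq _ _ Hj). }
split; [|exact Hs].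
(* Extended by 0 to all indices, the three parts can be added termwise; they recover [x], which
   vanishes on residues 1 and 4. *)
pose (part := fun j k => if Nat.eqb (k mod 5) j then x k else 0).
assert (Hp : forall j, (j < 5)%nat -> is_unordered_sum (part j)
    (unordered_sum (fun n => x (5 * n + j)%nat))).
{ intros j Hj. apply (is_unordered_sum_extend (fun n => (5 * n + j)%nat)).
  - intros; lia.
  - intros k Hk. unfold part. destruct (Nat.eqb_spec (k mod 5) j) as [E|]; [|easy].
    destruct (Hk (k / 5)%nat). assert (h := Nat.div_mod_eq k 5). lia.
  - eapply is_unordered_sum_ext; [|apply Hs]. intros n. unfold part.
    replace ((5 * n + j) mod 5)%nat with j; [now rewrite Nat.eqb_refl|].
    rewrite Nat.add_comm, Nat.mul_comm, Nat.Div0.mod_add.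
    symmetry. now apply Nat.mod_small. }
apply (is_unordered_sum_unique x); [exact Hl|].
eapply is_unordered_sum_ext;
  [|exact (is_unordered_sum_plus _ _ _ _ (is_unordered_sum_plus _ _ _ _
      (Hp 0%nat ltac:(lia)) (Hp 2%nat ltac:(lia))) (Hp 3%nat ltac:(lia)))].
intros k. unfold part. cbv beta.
destruct (classic (x k = 0)) as [E|E].
- rewrite E. destruct (Nat.eqb (k mod 5) 0), (Nat.eqb (k mod 5) 2), (Nat.eqb (k mod 5) 3); ring.
- destruct (Hx k E) as [-> | [-> | ->]]; simpl; ring.
Qed.

(** * Translation by 1, uniqueness of the components and admissible exponents *)

Lemma laurent_shift (c : R) f :
  in_qZ_laurent c f -> forall tau, upper_half tau ->
  f (tau + 1) = unit_root c * f tau.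
Proof.
intros [N [a H]] tau Ht.
assert (H1 := H _ (upper_half_shift _ Ht)).
eapply C_series_unique; [exact H1|].
eapply C_is_series_ext; [|apply C_is_series_scal, (H tau Ht)].
intros n. cbv beta. rewrite qpow_shift, unit_root_plus.
(* Integer shifts of the exponent do not change the multiplier, so every term picks up the same
   [unit_root c]. *)
rewrite (proj2 (unit_root_eq_1 (IZR (N + Z.of_nat n)))); [ring|].
now exists (N + Z.of_nat n)%Z.
Qed.

Lemma Cmult_eq_0 (x y : C) : x * y = 0 -> x = 0 \/ y = 0.
Proof.
intros E. destruct (classic (x = 0)) as [|X]; [now left|].
right. transitivity (/ x * (x * y)); [field; exact X|]. rewrite E; ring.
Qed.

Lemma Cminus_eq_0 (x y : C) : x - y = 0 -> x = y.
Proof. intros E. transitivity (x - y + y); [ring|]. rewrite E; ring. Qed.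

Lemma unit_root_neq (c d : R) :
  (-1 < c - d < 1)%R -> c <> d -> unit_root c <> unit_root d.
Proof.
intros H N E. apply unit_root_eq in E. destruct E as [k Hk].
assert (-1 < k < 1)%Z as K by (split; apply lt_IZR; lra).
assert (k = 0%Z) as -> by lia. lra.
Qed.

Lemma unit_root_0 : unit_root 0 = 1.
Proof. apply unit_root_eq_1. now exists 0%Z. Qed.

(* Comparing at tau, tau + 1 and tau + 2 gives a Vandermonde system. *)
Lemma decomposition_unique f f0 f2 f3 g0 g2 g3 :
  is_decomposition f f0 f2 f3 -> is_decomposition f g0 g2 g3 ->
  eq_on_upper_half f0 g0 /\ eq_on_upper_half f2 g2 /\ eq_on_upper_half f3 g3.
Proof.
intros [F0 [F2 [F3 F]]] [G0 [G2 [G3 G]]].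
pose (a := unit_root (2 / 5)). pose (b := unit_root (3 / 5)).
assert (sol : forall tau, upper_half tau ->
  f0 tau = g0 tau /\ f2 tau = g2 tau /\ f3 tau = g3 tau).
{ intros tau Ht.
  assert (Ht1 := upper_half_shift _ Ht). assert (Ht2 := upper_half_shift _ Ht1).
  assert (E0 := eq_trans (eq_sym (F _ Ht)) (G _ Ht)).
  assert (E1 := eq_trans (eq_sym (F _ Ht1)) (G _ Ht1)).
  assert (E2 := eq_trans (eq_sym (F _ Ht2)) (G _ Ht2)).
  cbv beta in E0, E1, E2.
  rewrite (laurent_shift _ _ F0 _ Ht1), (laurent_shift _ _ F2 _ Ht1),
    (laurent_shift _ _ F3 _ Ht1), (laurent_shift _ _ G0 _ Ht1),
    (laurent_shift _ _ G2 _ Ht1), (laurent_shift _ _ G3 _ Ht1) in E2.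
  rewrite (laurent_shift _ _ F0 _ Ht), (laurent_shift _ _ F2 _ Ht),
    (laurent_shift _ _ F3 _ Ht), (laurent_shift _ _ G0 _ Ht),
    (laurent_shift _ _ G2 _ Ht), (laurent_shift _ _ G3 _ Ht) in E1, E2.
  rewrite unit_root_0 in E1, E2. fold a b in E1, E2.
  assert (na : a - 1 <> 0).
  { intros h. apply Cminus_eq_0 in h. rewrite <- unit_root_0 in h.
    revert h. apply unit_root_neq; lra. }
  assert (nb : b - 1 <> 0).
  { intros h. apply Cminus_eq_0 in h. rewrite <- unit_root_0 in h.
    revert h. apply unit_root_neq; lra. }
  assert (nab : a - b <> 0).
  { intros h. apply Cminus_eq_0 in h. revert h. apply unit_root_neq; lra. }
  set (x0 := f0 tau) in *. set (x2 := f2 tau) in *. set (x3 := f3 tau) in *.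
  set (y0 := g0 tau) in *. set (y2 := g2 tau) in *. set (y3 := g3 tau) in *.
  clearbody x0 x2 x3 y0 y2 y3 a b.
  assert (D0 : x0 + x2 + x3 - (y0 + y2 + y3) = 0) by (rewrite E0; ring).
  assert (D1 : 1 * x0 + a * x2 + b * x3 - (1 * y0 + a * y2 + b * y3) = 0)
    by (rewrite E1; ring).
  assert (D2 : 1 * (1 * x0) + a * (a * x2) + b * (b * x3)
     - (1 * (1 * y0) + a * (a * y2) + b * (b * y3)) = 0)
    by (rewrite E2; ring).
  assert (comb : forall u v w z, z = u * (x0 + x2 + x3 - (y0 + y2 + y3))
     + v * (1 * x0 + a * x2 + b * x3 - (1 * y0 + a * y2 + b * y3))
     + w * (1 * (1 * x0) + a * (a * x2) + b * (b * x3)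
     - (1 * (1 * y0) + a * (a * y2) + b * (b * y3))) -> z = 0).
  { intros u v w z ->. rewrite D0, D1, D2. ring. }
  (* The weights are the coefficients of (X - a)(X - b), which kills the eigenvalues [a] and [b];
     the next two use (X - 1)(X - b) and -(X - 1)(X - a). *)
  assert (h0 : (a - 1) * ((b - 1) * (x0 - y0)) = 0)
    by (apply (comb (a * b) (- (a + b)) 1); ring).
  assert (h2 : (a - 1) * ((a - b) * (x2 - y2)) = 0)
    by (apply (comb b (- (1 + b)) 1); ring).
  assert (h3 : (b - 1) * ((a - b) * (x3 - y3)) = 0)
    by (apply (comb (- a) (1 + a) (- (1))); ring).
  repeat split; apply Cminus_eq_0.
  - destruct (Cmult_eq_0 _ _ h0) as [|h]; [easy|].
    now destruct (Cmult_eq_0 _ _ h).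
  - destruct (Cmult_eq_0 _ _ h2) as [|h]; [easy|].
    now destruct (Cmult_eq_0 _ _ h).
  - destruct (Cmult_eq_0 _ _ h3) as [|h]; [easy|].
    now destruct (Cmult_eq_0 _ _ h). }
repeat split; intros tau Ht; now apply sol.
Qed.

Lemma decomposition_exponents f f0 f2 f3 e :
  is_decomposition f f0 f2 f3 -> q_exponent_of f e ->
  cong_mod_Z e 0 \/ cong_mod_Z e (2 / 5) \/ cong_mod_Z e (3 / 5).
Proof.
intros [F0 [F2 [F3 F]]] [D [N [c [n [H [Hn ->]]]]]].
assert (K := has_q_series_shift _ _ _ (unit_root 0)
  (has_q_series_shift _ _ _ (unit_root (2 / 5))
  (has_q_series_shift _ _ _ (unit_root (3 / 5)) H))).
assert (E : forall n, (unit_root (frac_exponent D N n) - unit_root 0) *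
  ((unit_root (frac_exponent D N n) - unit_root (2 / 5)) *
  ((unit_root (frac_exponent D N n) - unit_root (3 / 5)) * c n)) = 0).
{ apply (frac_expansion_zero D N).
  intros tau Ht. specialize (K tau Ht). cbv beta in K.
  assert (Ht1 := upper_half_shift _ Ht). assert (Ht2 := upper_half_shift _ Ht1).
  rewrite (F _ (upper_half_shift _ Ht2)), (F _ Ht2), (F _ Ht1), (F _ Ht) in K.
  rewrite !(laurent_shift _ _ F0 _ Ht2), !(laurent_shift _ _ F2 _ Ht2),
    !(laurent_shift _ _ F3 _ Ht2), !(laurent_shift _ _ F0 _ Ht1),
    !(laurent_shift _ _ F2 _ Ht1), !(laurent_shift _ _ F3 _ Ht1),
    !(laurent_shift _ _ F0 _ Ht), !(laurent_shift _ _ F2 _ Ht),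
    !(laurent_shift _ _ F3 _ Ht) in K.
  (* Each component is an eigenvector killed by one of the three factors, so the transformed
     function is 0. *)
  match type of K with is_series _ ?v => replace v with (RtoC 0) in K end.
  - exact K.
  - ring. }
assert (sub : forall d, unit_root (frac_exponent D N n) - unit_root d = 0 ->
  cong_mod_Z (frac_exponent D N n) d).
{ intros d h. now apply unit_root_eq, Cminus_eq_0. }
destruct (Cmult_eq_0 _ _ (E n)) as [h|h]; [left; now apply sub|right].
destruct (Cmult_eq_0 _ _ h) as [h'|h']; [left; now apply sub|right].
destruct (Cmult_eq_0 _ _ h') as [h''|h'']; [now apply sub|easy].
Qed.

(** * Assembling the decomposition and its transformation law *)

Lemma zeta5_unit_root : zeta5 = unit_root (1 / 5).
Proof.
unfold zeta5, unit_root. f_equal. rewrite RtoC_div by lra. field.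
Qed.

Theorem mainTheorem7 :
  (exists (D : positive) (N : Z) (a : nat -> C),
      has_frac_expansion D N a Sstar) /\
  (forall e : R, q_exponent_of Sstar e ->
      cong_mod_Z e 0 \/ cong_mod_Z e (2 / 5) \/ cong_mod_Z e (3 / 5)) /\
  (exists S0 S2 S3 : C -> C,
      is_decomposition Sstar S0 S2 S3 /\
      (forall T0 T2 T3 : C -> C, is_decomposition Sstar T0 T2 T3 ->
         eq_on_upper_half T0 S0 /\ eq_on_upper_half T2 S2 /\
         eq_on_upper_half T3 S3) /\
      let V := fun tau : C => col3 (S0 tau) (S2 tau) (S3 tau) in
      forall tau : C, upper_half tau ->
        V (tau + 1) =
        Mmult (T := C_Ring) (diag3 1 (zeta5 ^ 2) (zeta5 ^ 3)) (V tau)).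
Proof.
destruct Sstar_expansion as [A [HA HS]].
assert (split_at : forall tau, upper_half tau ->
  Sstar tau = residue_part A 0 tau + residue_part A 2 tau + residue_part A 3 tau /\
  forall j, is_unordered_sum
    (fun n => RtoC (IZR (A (5 * n + j)%nat)) * qpow (1 / 5) tau ^ (5 * n + j))
    (unordered_sum (fun n =>
      RtoC (IZR (A (5 * n + j)%nat)) * qpow (1 / 5) tau ^ (5 * n + j)))).
{ intros tau Ht. destruct (HS tau Ht) as [l [M [Hl [HM E]]]].
  assert (Hx : forall k,
    RtoC (IZR (A k)) * qpow (1 / 5) tau ^ k <> 0 -> admissible k).
  { intros k Hk. apply HA. intros E0. apply Hk. rewrite E0. ring. }
  destruct (residue_split _ l M Hx HM Hl) as [El Hj].
  split; [|exact Hj]. rewrite E, El. unfold residue_part. ring. }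
assert (laurent : forall j,
  in_qZ_laurent (INR j / 5) (residue_part A j)).
{ intros j. exists (-60)%Z, (fun n => A (5 * n + j)%nat). intros tau Ht.
  eapply C_is_series_ext; [|apply C_is_series_scal, is_series_of_unordered,
    (proj2 (split_at tau Ht) j)].
  intros n. cbv beta. rewrite <- qpow_mul_INR.
  replace (INR j / 5 + IZR (-60 + Z.of_nat n))%R
    with (-60 + INR (5 * n + j) * (1 / 5))%R.
  - rewrite qpow_plus. ring.
  - rewrite plus_IZR, <- INR_IZR_INZ, plus_INR, mult_INR. simpl. field. }
assert (dec : is_decomposition Sstar
    (residue_part A 0) (residue_part A 2) (residue_part A 3)).
{ assert (h0 := laurent 0%nat). assert (h2 := laurent 2%nat).
  assert (h3 := laurent 3%nat).
  replace (INR 0 / 5)%R with 0%R in h0 by (simpl; field).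
  replace (INR 2 / 5)%R with (2 / 5)%R in h2 by (simpl; field).
  replace (INR 3 / 5)%R with (3 / 5)%R in h3 by (simpl; field).
  repeat split; [exact h0|exact h2|exact h3|].
  intros tau Ht. apply (split_at tau Ht). }
split; [|split].
(* In units of 1/5, the factor q^(-60) starts the expansion at -300. *)
- exists 5%positive, (-300)%Z, (fun k => RtoC (IZR (A k))). intros tau Ht.
  destruct (HS tau Ht) as [l [M [Hl [_ ->]]]].
  eapply C_is_series_ext;
    [|apply C_is_series_scal, is_series_of_unordered, Hl].
  intros n. cbv beta. rewrite <- qpow_mul_INR. unfold frac_exponent.
  replace (IZR (-300 + Z.of_nat n) / 5)%R with (-60 + INR n * (1 / 5))%R.
  + rewrite qpow_plus. ring.
  + rewrite plus_IZR, <- INR_IZR_INZ. field.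
- intros e. now apply decomposition_exponents with (1 := dec).
- exists (residue_part A 0), (residue_part A 2), (residue_part A 3).
  split; [exact dec|split].
  + intros T0 T2 T3 HT. now apply decomposition_unique with (1 := HT).
  + intros V tau Ht. destruct dec as [h0 [h2 [h3 _]]].
    unfold V. rewrite (laurent_shift _ _ h0 _ Ht), (laurent_shift _ _ h2 _ Ht),
      (laurent_shift _ _ h3 _ Ht), unit_root_0.
    replace (unit_root (2 / 5)) with (zeta5 ^ 2).
    2:{ rewrite zeta5_unit_root. simpl. rewrite Cmult_1_r, <- unit_root_plus.
        f_equal. field. }
    replace (unit_root (3 / 5)) with (zeta5 ^ 3).
    2:{ rewrite zeta5_unit_root. simpl. rewrite Cmult_1_r, <- !unit_root_plus.
        f_equal. field. }
    (* The matrices are compared entrywise: the single column forces [j = 0], and each entry of the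
       product is a sum over indices 0 to 2. *)
    apply mk_matrix_ext. intros i j Hi Hj.
    assert (j = 0%nat) as -> by lia.
    change (Nat.pred 3) with 2%nat. rewrite !sum_Sn, sum_O.
    change (@mult _ ?x ?y) with (x * y).
    unfold diag3, col3.
    destruct i as [|[|[|]]]; [| | |lia];
    rewrite !coeff_mat_bij by lia; simpl; repeat change (@plus _ ?x ?y) with (x + y); ring.
Qed.
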